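(* Let $\Sigma_{0,2,m}$ be an annulus with $m$ marked points on its boundary, with at least one marked point on each of the two boundary components. Let $\mathbb{F}_q$ be the finite field with $q$ elements. Then the number of $\mathbb{F}_q$-points of the corresponding cluster variety is $$\#\mathcal{A}(\Sigma_{0,2,m};\mathbb{F}_q)=(q-1)^m\big(q^m+(-1)^m\big).$$
   Context: $\Sigma_{g,b,m}$ denotes a smooth, oriented, compact surface of genus $g$ with $b$ boundary components and $m$ marked points on the boundary, at least one on each boundary component (no punctures). A boundary arc is a segment of the boundary between consecutive marked points (there are $m$ of them). A triangulation $T$ is a collection of pairwise non-crossing simple marked arcs (non-contractible curves with endpoints at marked points, up to homotopy) which, together with the boundary arcs, divides the surface into triangles. Cluster algebra: the ice quiver $Q_T$ of a triangulation $T$ has one frozen vertex for each boundary arc and one mutable vertex for each non-boundary arc of $T$; in each triangle draw arrows between its sides in clockwise order (omitting arrows between frozen vertices), then cancel pairs of opposite arrows. The initial seed consists of $Q_T$ together with algebraically independent variables $x_v$ indexed by its vertices. Mutation at a mutable vertex $k$ applies the usual quiver mutation and replaces $x_k$ by $x_k'$, where $x_kx_k'=\prod_{k\to j}x_j+\prod_{i\to k}x_i$ (products over arrows). Clusters are the sets of variables (frozen ones included) in seeds obtained by iterated mutation; they correspond to triangulations, and cluster variables to simple marked arcs. The cluster algebra $A(\Sigma_{g,b,m})$ is the $\mathbb{Z}$-subalgebra of $\mathbb{Q}(x_v)$ generated by all cluster variables and the inverses of all frozen variables (variables of boundary arcs); up to isomorphism it does not depend on $T$. The cluster variety over a field $\Bbbk$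 is $\mathcal{A}(\Sigma_{g,b,m};\Bbbk)=\operatorname{Spec}(A(\Sigma_{g,b,m})\otimes_{\mathbb{Z}}\Bbbk)$, and $\#\mathcal{A}(\Sigma_{g,b,m};\mathbb{F}_q)$ denotes its number of $\mathbb{F}_q$-points, i.e. the number of ring homomorphisms $A(\Sigma_{g,b,m})\to\mathbb{F}_q$. *)

(* Defs.v *)
From HB Require Import structures.
From mathcomp Require Import all_boot all_order all_algebra.
From mathcomp Require Import boolp classical_sets cardinality.
From mathcomp Require Import mpoly.

Set Implicit Arguments.
Unset Strict Implicit.
Unset Printing Implicit Defensive.

Import GRing.Theory.

Local Open Scope ring_scope.

(* A triangulated oriented surface is encoded by its gluing pattern: finitely
   many triangles, and for each of them the arcs side t 0, side t 1, side t 2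
   met along its perimeter in clockwise order.  An arc lying on one side only
   is a boundary arc; an arc lying on two sides glues them, the identification
   reversing the clockwise directions of the two sides (so that the triangles
   have compatible orientations). *)
Record gluing := Gluing {
  arc : finType;
  triangle : finType;
  side : triangle -> 'I_3 -> arc;
  sides_of_arc : forall a : arc,
    (0 < #|[pred d : triangle * 'I_3 | side d.1 d.2 == a]| <= 2)%N
}.

Section Gluing.
Variable T : gluing.

(* The i-th side of t is denoted (t, i); also, (t, i) denotes the corner of t
   from which that side starts when t is followed clockwise. *)
Definition dart : finType := (triangle T * 'I_3)%type.

Definition dart_arc (d : dart) : arc T := side d.1 d.2.

Definition next_side (d : dart) : dart := (d.1, ordS d.2).

Definition boundary_arc (a : arc T) : bool :=
  #|[pred d : dart | dart_arc d == a]| == 1%N.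

(* The side glued to d, or d itself if d lies on the boundary. *)
Definition opp (d : dart) : dart :=
  odflt d [pick d' : dart | (dart_arc d' == dart_arc d) && (d' != d)].

(* If d is not on the boundary, its start is the end of opp d, hence the start
   of next_side (opp d).  If d is on the boundary, next_side (opp d) is
   next_side d, which starts at the end of d.  So iterating turn pivots around
   a point until a boundary side is reached, then moves along it, and so on:
   the orbits with a boundary side are in bijection with the boundary
   components, and the other ones with the interior points (punctures). *)
Definition turn (d : dart) : dart := next_side (opp d).

Definition same_point : rel dart := fun c d =>
  (~~ boundary_arc (dart_arc c) && (turn c == d)) ||
  (~~ boundary_arc (dart_arc d) && (turn d == c)).

Definition nb_points : nat := n_comp same_point {: dart}.

Definition no_puncture : bool :=
  [forall c : dart, exists d : dart,
     connect same_point c d && boundary_arc (dart_arc d)].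

Definition nb_boundary_components : nat :=
  fcard turn (fclosure turn [pred d : dart | boundary_arc (dart_arc d)]).

Definition adjacent : rel (triangle T) := fun t t' =>
  [exists i, exists j, side t i == side t' j].

Definition connected_surface : bool := n_comp adjacent {: triangle T} == 1%N.

(* The genus is prescribed by the Euler characteristic, V - E + F = 2 - 2g - b,
   written without subtractions. *)
Definition triangulates (g b m : nat) : Prop :=
  [/\ connected_surface,
      no_puncture,
      nb_points = m,
      nb_boundary_components = b &
      (nb_points + #|triangle T| + 2 * g + b = 2 + #|arc T|)%N].

End Gluing.

(* arrows i j is the number of arrows from i to j. *)
Record ice_quiver := IceQuiver {
  vertex : finType;
  frozen : pred vertex;
  arrows : vertex -> vertex -> nat
}.

Section ClusterAlgebra.
Variable Q : ice_quiver.
Local Notation V := (vertex Q).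

(* The field Q(x_v : v in V). *)
Definition ambient_field : fieldType := {fraction {mpoly rat[#|V|]}}.

Record seed := Seed {
  seed_arrows : V -> V -> nat;
  seed_var : V -> ambient_field
}.

Definition initial_seed : seed :=
  {| seed_arrows := @arrows Q;
     seed_var := fun v => FracField.tofrac 'X_(enum_rank v) |}.

(* For i, j <> k: add an arrow i -> j for each path i -> k -> j, then cancel
   pairs of opposite arrows (the subtraction is truncated).  Arrows between
   frozen vertices are omitted.  Arrows at k are reversed. *)
Definition mutate_arrows (k : V) (a : V -> V -> nat) : V -> V -> nat :=
  fun i j =>
    if (i == k) || (j == k) then a j i
    else if frozen i && frozen j then 0%N
    else ((a i j + a i k * a k j) - (a j i + a j k * a k i))%N.

Definition mutate_var (k : V) (s : seed) : V -> ambient_field :=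
  fun v =>
    if v == k then
      (\prod_(j : V) seed_var s j ^+ seed_arrows s k j +
       \prod_(i : V) seed_var s i ^+ seed_arrows s i k) / seed_var s k
    else seed_var s v.

Definition mutate (k : V) (s : seed) : seed :=
  {| seed_arrows := mutate_arrows k (seed_arrows s);
     seed_var := mutate_var k s |}.

Inductive reachable : seed -> Prop :=
| reachable_initial : reachable initial_seed
| reachable_mutate k s : ~~ frozen k -> reachable s -> reachable (mutate k s).

Definition cluster_variable (z : ambient_field) : Prop :=
  exists s v, reachable s /\ z = seed_var s v.

Inductive in_cluster_algebra : ambient_field -> Prop :=
| in_cluster_algebra1 : in_cluster_algebra 1
| in_cluster_algebraB x y :
    in_cluster_algebra x -> in_cluster_algebra y -> in_cluster_algebra (x - y)
| in_cluster_algebraM x y :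
    in_cluster_algebra x -> in_cluster_algebra y -> in_cluster_algebra (x * y)
| in_cluster_algebra_var z : cluster_variable z -> in_cluster_algebra z
| in_cluster_algebra_inv v :
    frozen v -> in_cluster_algebra (seed_var initial_seed v)^-1.

Definition cluster_algebra_pred : {pred ambient_field} :=
  fun z => `[< in_cluster_algebra z >].

Lemma cluster_algebra_subring : subring_closed cluster_algebra_pred.
Proof.
split; first exact/asboolP/in_cluster_algebra1.
- by move=> x y /asboolP hx /asboolP hy; apply/asboolP/in_cluster_algebraB.
- by move=> x y /asboolP hx /asboolP hy; apply/asboolP/in_cluster_algebraM.
Qed.

HB.instance Definition _ :=
  GRing.isSubringClosed.Build ambient_field cluster_algebra_pred
    cluster_algebra_subring.

Record cluster_algebra := ClusterAlgebra {
  cluster_algebra_val :> ambient_field;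
  cluster_algebra_valP : cluster_algebra_val \in cluster_algebra_pred
}.

HB.instance Definition _ := [isSub for cluster_algebra_val].
HB.instance Definition _ := [Choice of cluster_algebra by <:].
HB.instance Definition _ := [SubChoice_isSubComNzRing of cluster_algebra by <:].

(* The F-points of Spec (A (x)_Z F) are the ring morphisms from A to F. *)
Definition cluster_variety_points (F : fieldType) : set (cluster_algebra -> F) :=
  [set f | zmod_morphism f /\ monoid_morphism f]%classic.

End ClusterAlgebra.

Section TriangulationQuiver.
Variable T : gluing.

(* Number of triangle corners at which j follows i in clockwise order. *)
Definition clockwise_steps (i j : arc T) : nat :=
  #|[pred d : dart T | (dart_arc d == i) && (dart_arc (next_side d) == j)]|.

Definition triangulation_quiver : ice_quiver :=
  {| vertex := arc T;
     frozen := @boundary_arc T;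
     arrows := fun i j =>
       if boundary_arc i && boundary_arc j then 0%N
       else (clockwise_steps i j - clockwise_steps j i)%N |}.

End TriangulationQuiver.

(* Main.v *)
From mathcomp Require Import all_boot all_order all_algebra.
From mathcomp Require Import boolp classical_sets cardinality.
From mathcomp Require Import mpoly zify ring.
Require Import Defs.

Set Implicit Arguments.
Unset Strict Implicit.
Unset Printing Implicit Defensive.

Import Order.TTheory GRing.Theory Num.Theory.

(* Flips of a triangulation are encoded on its fixed set of sides: only the
   permutation nx which turns clockwise in the triangles changes, and a flip
   mutates the quiver because there is no puncture.  Colour the marked points by
   their boundary component.  As long as some triangle has its three corners of
   the same colour, there is an arc between such a triangle and a two-coloured
   one, and flipping it increases the number of two-coloured triangles.  So we
   reach a triangulation whose triangles are all two-coloured; by the Euler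
   characteristic it consists of a cycle of m bridging arcs e_k and of one
   boundary arc b_k in each of its m triangles.

   In this seed the cluster algebra A is generated by the e_k, their mutations
   e'_k, the b_k and the 1/b_k.  Indeed, cluster variables are the
   lambda-lengths of a decorated twisted SL2-local system; flips do not leave
   the subring generated by the coordinates of its vectors and of its
   transition matrices, and these can be chosen among the above generators.

   So a morphism f : A -> F is determined by the values of e_k, e'_k and b_k.
   Since both boundary components have marked points, no two consecutive e_k
   vanish; where f e_k = 0, the exchange relation gives b_k in terms of e'_k
   and of the other coordinates.  Conversely, any values of the coordinates
   (e_k, b_k or e'_k) satisfying these constraints are attained: evaluating
   first rational functions of the initial cluster at a point of Q(z), and then
   rational functions of z at the given values, is defined on the generators,
   hence on A.  Counting these values along the cycle is the computation of the
   trace of the m-th power of a 2x2 matrix with eigenvalues q (q - 1) and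
   -(q - 1). *)

(** * Flips *)

Section Flips.
Variables (D V : finType) (ar : D -> V) (opp : D -> D).
Hypothesis oppK : involutive opp.
Hypothesis ar_opp : forall x, ar (opp x) = ar x.
Hypothesis ar_eq : forall x y, ar x = ar y -> y = x \/ y = opp x.

Definition triangular (nx : D -> D) :=
  (forall x, nx (nx (nx x)) = x) /\ (forall x, nx x != x).

(** Iterating [nx \o opp] pivots around the start of a dart, and a fixed point of [opp] is a
    boundary side: the start of every dart lies on the boundary. *)
Definition unpunctured (nx : D -> D) :=
  forall x, exists n, let y := iter n (fun y => nx (opp y)) x in opp y == y.

(** Connectedness of the surface, in the form of an induction principle on darts. *)
Definition transitive_on_darts (nx : D -> D) :=
  forall S : pred D, (exists x, S x) -> (forall x, S x -> S (nx x)) ->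
    (forall x, S x -> S (opp x)) -> forall x, S x.

(* The quadrilateral d, a, b, d', c, e around the diagonal d, d' = opp d is
   recut along its other diagonal, which keeps the darts d and d'. *)
Definition flip (nx : D -> D) (d : D) : D -> D := fun x =>
  let d' := opp d in
  if x == d then nx (nx d) else
  if x == nx d then d' else
  if x == nx (nx d) then nx d' else
  if x == d' then nx (nx d') else
  if x == nx d' then d else
  if x == nx (nx d') then nx d else nx x.

Definition quadrilateral (nx : D -> D) (d : D) :=
  [:: d; nx d; nx (nx d); opp d; nx (opp d); nx (nx (opp d))].

Section State.
Variable nx : D -> D.
Hypotheses (nx3 : triangular nx) (nxP : unpunctured nx).

Let nxK x : nx (nx (nx x)) = x. Proof. exact: nx3.1. Qed.
Let nxN x : nx x != x. Proof. exact: nx3.2. Qed.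

Lemma triangular_inj : injective nx.
Proof. by move=> x y e; rewrite -(nxK x) e nxK. Qed.

Lemma triangular_neq2 x : nx (nx x) != x.
Proof. by apply/eqP=> e; move: (nxK x) (nxN x) => h /eqP; congruence. Qed.

(** Otherwise the pivot orbit of [x] would be constant and never meet the boundary: a puncture with
    a single arc end. *)
Lemma turn_neq x : opp x != x -> nx (opp x) != x.
Proof.
move=> hx; apply/eqP=> e; case: (nxP x) => n /=.
have -> : iter n (fun y => nx (opp y)) x = x by elim: n => //= n ->.
by rewrite (negbTE hx).
Qed.

Lemma turn2_neq x : opp x != x -> opp (nx (opp x)) != nx (opp x) ->
  nx (opp (nx (opp x))) != x.
Proof.
move=> hx hy; apply/eqP=> e; case: (nxP x) => n /=.
have : iter n (fun y => nx (opp y)) x = x \/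
       iter n (fun y => nx (opp y)) x = nx (opp x).
  by elim: n => [|n [] /= ->]; [left|right|left].
by case=> ->; [rewrite (negbTE hx) | rewrite (negbTE hy)].
Qed.

Section Quad.
Variable d : D.
Hypothesis dN : opp d != d.

(** Gluing two sides of one triangle would fold it around a puncture, so the two sides of an
    interior arc lie in different triangles. *)
Lemma quad_opp : (opp d != nx d) /\ (opp d != nx (nx d)).
Proof.
split; apply/eqP=> e.
  have h : opp (opp d) != opp d by rewrite oppK eq_sym.
  by have := turn_neq h; rewrite oppK -e eqxx.
by have := turn_neq dN; rewrite e nxK eqxx.
Qed.

Lemma quad_uniq : uniq (quadrilateral nx d).
Proof.
have [/eqP h1 /eqP h2] := quad_opp; move/eqP: (dN) => h0.
move: (nxK d) (nxK (opp d)) => k k'.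
have /eqP n1 := nxN d; have /eqP n2 := nxN (opp d).
have /eqP n3 := triangular_neq2 d; have /eqP n4 := triangular_neq2 (opp d).
rewrite /= !inE !negb_or.
by repeat (apply/andP; split); rewrite //; apply/eqP; congruence.
Qed.

Lemma flip_out x : x \notin quadrilateral nx d ->
  flip nx d x = nx x /\ nx x \notin quadrilateral nx d.
Proof.
rewrite /quadrilateral !inE !negb_or => /and5P[n1 n2 n3 n4 /andP[n5 n6]]; split.
  by rewrite /flip; do 6![rewrite ifN //].
move: (nxK d) (nxK (opp d)) (nxK x) => k k' k''; move/eqP: n1 n2 n3 n4 n5 n6.
move=> n1 /eqP n2 /eqP n3 /eqP n4 /eqP n5 /eqP n6.
by do ![apply/andP; split]; rewrite //; apply/eqP; congruence.
Qed.

Lemma flip_in :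
  [/\ flip nx d d = nx (nx d), flip nx d (nx (nx d)) = nx (opp d) &
      flip nx d (nx (opp d)) = d] /\
  [/\ flip nx d (opp d) = nx (nx (opp d)), flip nx d (nx (nx (opp d))) = nx d &
      flip nx d (nx d) = opp d].
Proof.
have := quad_uniq; rewrite /flip /= !inE !negb_or.
case/and5P=> /and5P[a1 a2 a3 a4 a5] /and4P[b1 b2 b3 b4] /and3P[c1 c2 c3].
move=> /andP[e1 e2] /andP[f1 _].
repeat match goal with H : is_true (_ != _) |- _ => move/eqP in H end.
by split; split; repeat (case: eqP => ?); congruence.
Qed.

Lemma quadP (P : D -> Prop) : P d -> P (nx d) -> P (nx (nx d)) -> P (opp d) ->
  P (nx (opp d)) -> P (nx (nx (opp d))) ->
  (forall x, x \notin quadrilateral nx d -> P x) -> forall x, P x.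
Proof.
move=> p1 p2 p3 p4 p5 p6 q x.
have [|/q//] := boolP (x \in quadrilateral nx d).
by rewrite !inE; do 5![case/orP=> [/eqP->//|]]; move/eqP->.
Qed.

Lemma flip_triangular : triangular (flip nx d).
Proof.
have [[f1 f2 f3] [f4 f5 f6]] := flip_in.
have := quad_uniq; rewrite /= !inE !negb_or.
case/and5P=> /and5P[a1 a2 a3 a4 a5] /and4P[b1 b2 b3 b4] /and3P[c1 c2 c3].
move=> /andP[e1 e2] /andP[g1 _].
split; apply: quadP; rewrite ?(f1, f2, f3, f4, f5, f6) //; try by rewrite eq_sym.
  by move=> x /flip_out[-> /flip_out[-> /flip_out[-> _]]]; rewrite nxK.
by move=> x /flip_out[-> _].
Qed.

(** A pivot orbit changes only at the corners of the quadrilateral, where a dart of the new diagonal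
    is inserted or one of the old diagonal is skipped. *)
Lemma flip_unpunctured : unpunctured (flip nx d).
Proof.
have [[f1 f2 f3] [f4 f5 f6]] := flip_in.
have := quad_uniq; rewrite /= !inE !negb_or.
case/and5P=> /and5P[a1 a2 a3 a4 a5] /and4P[b1 b2 b3 b4] /and3P[c1 c2 c3].
move=> /andP[e1 e2] /andP[g1 _].
have [na na' nb nb'] : [/\ nx d != d, nx d != opp d, nx (nx d) != d &
    nx (nx d) != opp d] by split=> //; rewrite eq_sym.
have [nc nc' ne ne'] : [/\ nx (opp d) != d, nx (opp d) != opp d,
    nx (nx (opp d)) != d & nx (nx (opp d)) != opp d].
  by split=> //; rewrite eq_sym.
set t := fun y => nx (opp y); set t' := fun y => flip nx d (opp y).
have tout y : opp y \notin quadrilateral nx d -> t' y = t y.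
  by rewrite /t' => /flip_out[-> _].
(* Strong induction on the length of the old orbit. The start [x] avoids the diagonal, whose darts
   start at other corners after the flip. *)
have H n : forall x, x != d -> x != opp d ->
    opp (iter n t x) == iter n t x -> exists m, opp (iter m t' x) == iter m t' x.
  have [N le_nN] := ubnP n; elim: N n le_nN => // N IH [|n] le_nN x xd xd'.
    by move=> h; exists 0.
  have step y p : y != d -> y != opp d -> y = iter p.+1 t' x ->
      (forall k, k <= n -> opp (iter k t y) == iter k t y ->
      exists m, opp (iter m t' x) == iter m t' x).
    move=> yd yd' ye k lek hk; have [|m hm] := IH k _ y yd yd' hk; first exact: leq_ltn_trans lek _.
    by exists (m + p.+1); rewrite iterD -ye.
  (* When [opp x] is [nx d] or [nx (opp d)], the new diagonal costs one extra step; when it is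
     [nx (nx d)] or [nx (nx (opp d))], the old one is passed over. *)
  rewrite iterSr => h; have [ox|ox] := eqVneq (opp x) (nx d).
    have tx : t x = nx (nx d) by rewrite /t ox.
    have t'x : t' x = opp d by rewrite /t' ox f6.
    apply: (step (nx (nx d)) 1 _ _ _ n) => //.
      by rewrite /= t'x /t' oppK f1.
    by rewrite -tx.
  have [oy|oy] := eqVneq (opp x) (nx (opp d)).
    have tx : t x = nx (nx (opp d)) by rewrite /t oy.
    have t'x : t' x = d by rewrite /t' oy f3.
    apply: (step (nx (nx (opp d))) 1 _ _ _ n) => //.
      by rewrite /= t'x /t' f4.
    by rewrite -tx.
  have nd : opp d != d by rewrite eq_sym.
  have [oz|oz] := eqVneq (opp x) (nx (nx d)).
    have tx : t x = d by rewrite /t oz nxK.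
    have t'x : t' x = nx (opp d) by rewrite /t' oz f2.
    case: n le_nN step h => [|n] le_nN step; rewrite tx ?(negbTE nd) //=.
    rewrite -[t (iter n t d)]iterS iterSr => h.
    apply: (step (nx (opp d)) 0 _ _ _ n) => //.
  have [ow|ow] := eqVneq (opp x) (nx (nx (opp d))).
    have tx : t x = opp d by rewrite /t ow nxK.
    have t'x : t' x = nx d by rewrite /t' ow f5.
    case: n le_nN step h => [|n] le_nN step; rewrite tx ?oppK ?a3 ?(negbTE a3) //=.
    rewrite -[t (iter n t _)]iterS iterSr {2 4}/t oppK => h.
    by apply: (step (nx d) 0 _ _ _ n) => //.
  have xq : opp x \notin quadrilateral nx d.
    rewrite /quadrilateral !inE !negb_or ox oy oz ow !andbT /=.
    by rewrite (can2_eq oppK oppK) xd' (inj_eq (can_inj oppK)).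
  have [_] := flip_out xq; rewrite -/(t x) !inE !negb_or => /and5P[k1 _ _ k2 _].
  by apply: (step (t x) 0 _ _ _ n) => //=; rewrite -tout.
have {}H x : x != d -> x != opp d -> exists m, opp (iter m t' x) == iter m t' x.
  by move=> xd xd'; case: (nxP x) => n /= /H; apply.
have H' x : t' x != d -> t' x != opp d ->
    exists m, opp (iter m t' x) == iter m t' x.
  by move=> xd xd'; have [m hm] := H _ xd xd'; exists m.+1; rewrite iterSr.
move=> x; have [->|xd] := eqVneq x d.
  by apply: H'; rewrite /t' f4.
have [->|xd'] := eqVneq x (opp d); last exact: H.
by apply: H'; rewrite /t' oppK f1.
Qed.

(** A set stable after the flip that meets the quadrilateral contains its six darts, and [nx] is
    unchanged elsewhere; so the set was already stable before the flip. *)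
Lemma flip_transitive : transitive_on_darts nx -> transitive_on_darts (flip nx d).
Proof.
have [[f1 f2 f3] [f4 f5 f6]] := flip_in.
move=> tr S Sn Sf So; apply: tr => // x Sx; move: Sx.
have allS : S d -> all S (quadrilateral nx d).
  move=> h; have h' := So _ h; have h1 := Sf _ h; rewrite f1 in h1.
  have h2 := Sf _ h1; rewrite f2 in h2; have h3 := Sf _ h'; rewrite f4 in h3.
  have h4 := Sf _ h3; rewrite f5 in h4.
  by rewrite /= h h' h1 h2 h3 h4.
have back y : S (flip nx d y) -> S y.
  by move=> /Sf/Sf; rewrite (flip_triangular.1).
have quadS y : y \in quadrilateral nx d -> S y -> S d.
  rewrite !inE; case/or4P=> [/eqP->|/eqP->|/eqP->|/or3P[/eqP->|/eqP->|/eqP->]] //.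
  - by rewrite -f5 => /back; rewrite -f4 => /back/So; rewrite oppK.
  - by rewrite -f1 => /back.
  - by move=> /So; rewrite oppK.
  - by move=> /Sf; rewrite f3.
  - by rewrite -f4 => /back/So; rewrite oppK.
have [xq /(quadS _ xq)/allS/allP aS|xq] := boolP (x \in quadrilateral nx d).
  apply: aS; move: xq; rewrite !inE.
  by case/or4P=> [/eqP->|/eqP->|/eqP->|/or3P[/eqP->|/eqP->|/eqP->]];
    rewrite ?nxK ?eqxx ?orbT.
by move=> /Sf; rewrite (flip_out xq).1.
Qed.

End Quad.

(** Two consecutive sides of the quadrilateral glued together would enclose a puncture with one or
    two arc ends. Consequently arrows out of the diagonal never cancel arrows into it. *)
Lemma quad_arcs d : opp d != d ->
  [/\ ar (nx d) != ar (nx (nx d)), ar (nx d) != ar (nx (nx (opp d))),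
      ar (nx (opp d)) != ar (nx (nx d)) &
      ar (nx (opp d)) != ar (nx (nx (opp d)))].
Proof.
have key e : opp e != e -> ar (nx e) != ar (nx (nx e)) /\
    ar (nx e) != ar (nx (nx (opp e))).
  move=> eN.
  have ne : nx (nx (opp e)) != nx e.
    have := quad_uniq eN; rewrite /= !inE !negb_or => /andP[_ /andP[/and4P[_ _ _ h] _]].
    by rewrite eq_sym.
  split; apply/eqP=> /ar_eq[] h.
  - by move: (nxN (nx e)); rewrite h eqxx.
  - have bN : opp (nx (nx e)) != nx (nx e) by rewrite h oppK -h eq_sym nxN.
    by have := turn_neq bN; rewrite {1}h oppK eqxx.
  - by rewrite h eqxx in ne.
  - have e'N : opp (opp e) != opp e by rewrite oppK eq_sym.
    have hN : opp (nx (opp (opp e))) != nx (opp (opp e)) by rewrite oppK -h.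
    by have := turn2_neq e'N hN; rewrite oppK -h nxK eqxx.
move=> dN; have [k1 k2] := key d dN.
have [|k3 k4] := key (opp d); first by rewrite oppK eq_sym.
by rewrite oppK in k4; split.
Qed.

End State.
End Flips.

(** * Flips and mutations *)

Section Arrows.
Variables (D : finType) (Q : ice_quiver) (ar : D -> vertex Q) (opp : D -> D).
Hypothesis oppK : involutive opp.
Hypothesis ar_opp : forall x, ar (opp x) = ar x.
Hypothesis ar_eq : forall x y, ar x = ar y -> y = x \/ y = opp x.
Hypothesis frozen_ar : forall x, frozen (ar x) = (opp x == x).

Definition steps (nx : D -> D) (i j : vertex Q) : nat :=
  #|[pred x | (ar x == i) && (ar (nx x) == j)]|.

Definition dart_arrows (nx : D -> D) (i j : vertex Q) : nat :=
  if frozen i && frozen j then 0 else steps nx i j - steps nx j i.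

Lemma stepsE nx i j :
  steps nx i j = \sum_x ((ar x == i) && (ar (nx x) == j)).
Proof.
rewrite /steps -sum1_card big_mkcond /=; apply: eq_bigr => x _.
by rewrite inE; case: (_ && _).
Qed.

Section State.
Variable nx : D -> D.
Hypotheses (nx3 : triangular nx) (nxP : unpunctured opp nx).
Variable d : D.
Hypothesis dN : opp d != d.
Let a := ar (nx d).
Let b := ar (nx (nx d)).
Let c := ar (nx (opp d)).
Let e := ar (nx (nx (opp d))).
Let k := ar d.

Lemma steps_quad f i j : (forall x, x \notin quadrilateral opp nx d -> f x = nx x) ->
  (steps f i j =
  \sum_(x <- quadrilateral opp nx d) ((ar x == i) && (ar (f x) == j))
  + \sum_(x | x \notin quadrilateral opp nx d) ((ar x == i) && (ar (nx x) == j)))%N.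
Proof.
move=> fE; rewrite stepsE (bigID (mem (quadrilateral opp nx d))) /=.
by rewrite -big_uniq ?quad_uniq //; congr (_ + _)%N; apply: eq_bigr => x /fE->.
Qed.

(** Away from the diagonal, the flip trades the corners from [a] to [b] and from [c] to [e] for
    corners from [b] to [c] and from [e] to [a]. The balance is written with sums to avoid truncated
    subtraction. *)
Lemma steps_flip i j : i != k -> j != k ->
  (steps (flip opp nx d) i j + (a == i) * (b == j) + (c == i) * (e == j)
   = steps nx i j + (b == i) * (c == j) + (e == i) * (a == j))%N.
Proof.
move=> ik jk.
have [[f1 f2 f3] [f4 f5 f6]] := flip_in oppK nx3 nxP dN.
rewrite (steps_quad _ _ (fun x hx => (flip_out nx3 hx).1)).
rewrite (@steps_quad nx) // !big_cons !big_nil f1 f2 f3 f4 f5 f6.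
rewrite !nx3.1 !ar_opp -/k -/a -/b -/c -/e !(eq_sym k) (negbTE ik) (negbTE jk) /=.
rewrite !andbF /=; set s := (\sum_(_ | _) _)%N; by rewrite !mulnb; ring.
Qed.

Lemma ar_dart x : (ar x == k) = (x \in [:: d; opp d]).
Proof.
rewrite !inE; apply/eqP/orP => [/esym/ar_eq[]->|[]/eqP->//].
- by left.
- by right.
Qed.

Let dart_uniq : uniq [:: d; opp d].
Proof. by rewrite /= inE eq_sym dN. Qed.

Lemma steps_from j : steps nx k j = ((a == j) + (c == j))%N.
Proof.
rewrite stepsE (bigID (mem [:: d; opp d])) /= [X in (_ + X)%N]big1 ?addn0.
  rewrite -(big_uniq _ dart_uniq) /= !big_cons big_nil ar_opp -/k eqxx.
  by rewrite addn0.
by move=> x; rewrite -ar_dart => /negbTE->.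
Qed.

Lemma steps_to j : steps nx j k = ((b == j) + (e == j))%N.
Proof.
rewrite stepsE (reindex_inj (inj_comp (triangular_inj nx3) (triangular_inj nx3))) /=.
rewrite (bigID (mem [:: d; opp d])) /= [X in (_ + X)%N]big1 ?addn0.
  rewrite -(big_uniq _ dart_uniq) /= !big_cons big_nil !nx3.1 ar_opp -/k eqxx.
  by rewrite !andbT addn0.
by move=> x; rewrite nx3.1 -ar_dart => /negbTE->; rewrite andbF.
Qed.

Let kN : frozen k = false. Proof. by rewrite frozen_ar (negbTE dN). Qed.

Lemma arrows_from j : dart_arrows nx k j = ((a == j) + (c == j))%N.
Proof.
have [] := quad_arcs oppK ar_eq nx3 nxP dN; rewrite -/a -/b -/c -/e => n1 n2 n3 n4.
rewrite /dart_arrows kN steps_from steps_to.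
case: (eqVneq a j) n1 n2 => [<-|_ _ _].
  by rewrite ![_ == a]eq_sym ![a == _]eq_sym => /negbTE-> /negbTE->; rewrite subn0.
case: (eqVneq c j) n3 n4 => [<-|_ _ _] //.
by rewrite ![_ == c]eq_sym ![c == _]eq_sym => /negbTE-> /negbTE->.
Qed.

Lemma arrows_to j : dart_arrows nx j k = ((b == j) + (e == j))%N.
Proof.
have [] := quad_arcs oppK ar_eq nx3 nxP dN; rewrite -/a -/b -/c -/e => n1 n2 n3 n4.
rewrite /dart_arrows kN andbF steps_from steps_to.
case: (eqVneq b j) n1 n3 => [<-|_ _ _].
  by move=> /negbTE-> /negbTE->; rewrite subn0.
by case: (eqVneq e j) n2 n4 => [<-|_ _ _] // /negbTE-> /negbTE->.
Qed.

End State.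

(** Among the four paths through the diagonal, two are the corners created by the flip, and the
    other two reverse the corners that it removes. *)
Lemma truncated_flip (s1 s2 s3 s4 ai aj bi bj ci cj ei ej : nat) :
  (s3 + ai * bj + ci * ej = s1 + bi * cj + ei * aj ->
   s4 + aj * bi + cj * ei = s2 + bj * ci + ej * ai ->
   s3 - s4 = s1 - s2 + (bi + ei) * (aj + cj) - (s2 - s1 + (bj + ej) * (ai + ci)))%N.
Proof. by rewrite !mulnDl !mulnDr; lia. Qed.

Lemma flip_arrows nx d : triangular nx -> unpunctured opp nx -> opp d != d ->
  dart_arrows (flip opp nx d) = mutate_arrows (ar d) (dart_arrows nx).
Proof.
move=> nx3 nxP dN; have f3 := flip_triangular oppK nx3 nxP dN.
have fP := flip_unpunctured oppK nx3 nxP dN.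
have [[f1 f2 g3] [f4 f5 f6]] := flip_in oppK nx3 nxP dN.
apply: funext => i; apply: funext => j; rewrite /mutate_arrows.
have [->|ik] := eqVneq i (ar d).
  by rewrite (arrows_from f3 fP dN) (arrows_to nx3 nxP dN) f1 f4.
have [->|jk] := eqVneq j (ar d).
  by rewrite (arrows_to f3 fP dN) (arrows_from nx3 nxP dN) f1 f4 f2 f5 addnC.
rewrite /= (arrows_to nx3 nxP dN i) (arrows_from nx3 nxP dN j).
rewrite (arrows_to nx3 nxP dN j) (arrows_from nx3 nxP dN i).
rewrite /dart_arrows; case: ifP => // h; rewrite [frozen j && _]andbC h.
by apply: truncated_flip; apply: steps_flip.
Qed.

Lemma flip_var nx d (s : seed Q) : triangular nx -> unpunctured opp nx ->
  opp d != d -> seed_arrows s = dart_arrows nx ->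
  mutate_var (ar d) s (ar d) =
    ((seed_var s (ar (nx d)) * seed_var s (ar (nx (opp d))) +
     seed_var s (ar (nx (nx d))) * seed_var s (ar (nx (nx (opp d)))))
     / seed_var s (ar d))%R.
Proof.
move=> nx3 nxP dN sE; rewrite /mutate_var eqxx sE.
have E (x y : vertex Q) :
   (\prod_j seed_var s j ^+ ((x == j) + (y == j))%N = seed_var s x * seed_var s y)%R.
  transitivity (\prod_j (seed_var s j ^+ (x == j) * seed_var s j ^+ (y == j)))%R.
    by apply: eq_bigr => j _; rewrite exprD.
  rewrite big_split /=; congr (_ * _)%R.
    by rewrite (bigD1 x) //= eqxx big1 ?mulr1 // => j; rewrite eq_sym => /negbTE->.
  by rewrite (bigD1 y) //= eqxx big1 ?mulr1 // => j; rewrite eq_sym => /negbTE->.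
congr ((_ + _) / _)%R.
  by rewrite -E; apply: eq_bigr => j _; rewrite (arrows_from nx3 nxP dN).
by rewrite -E; apply: eq_bigr => j _; rewrite (arrows_to nx3 nxP dN).
Qed.

End Arrows.

(** * Seeds and evaluations of rational functions *)

Section Seeds.
Variable Q : ice_quiver.
Local Notation V := (vertex Q).
Local Notation K := (ambient_field Q).
Local Open Scope ring_scope.

(** The quivers without loops, two-cycles or arrows between frozen vertices; on them mutation is an
    involution despite the truncated subtraction. *)
Definition cancelled (a : V -> V -> nat) :=
  forall i j, (a i j = 0%N \/ a j i = 0%N) /\ (frozen i -> frozen j -> a i j = 0%N).

Lemma mutate_arrows_cancelled k a : ~~ frozen k ->
  cancelled a -> cancelled (mutate_arrows k a).
Proof.
move=> kN aP i j; split; last first.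
  move=> fi fj; rewrite /mutate_arrows fi fj; case: ifP => // _.
  exact: (aP j i).2.
rewrite /mutate_arrows orbC andbC; case: ifP => _; first exact: (aP j i).1.
by case: ifP => _; first left; lia.
Qed.

Lemma mutate_arrowsK k a : ~~ frozen k -> cancelled a ->
  mutate_arrows k (mutate_arrows k a) = a.
Proof.
move=> kN aP; apply: funext => i; apply: funext => j; rewrite /mutate_arrows.
have [->|ik] := eqVneq i k; first by rewrite eqxx orbT.
have [->|jk] := eqVneq j k; first by rewrite eqxx.
rewrite !eqxx !orbT /= [frozen j && _]andbC.
have [/andP[fi fj]|_] := boolP (frozen i && frozen j); first by rewrite (aP i j).2.
by case: (aP i j).1 => ->; lia.
Qed.

Lemma mutateK k s : ~~ frozen k -> cancelled (seed_arrows s) ->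
  seed_var s k != 0 -> seed_var (mutate k s) k != 0 -> mutate k (mutate k s) = s.
Proof.
case: s => a y /= kN aP yk y'k; rewrite /mutate /= mutate_arrowsK //.
congr Seed; apply: funext => v; rewrite /mutate_var /=.
have [->|//] := eqVneq v k.
have akk : a k k = 0%N by case: (aP k k).1.
have E (b : V -> nat) : b k = 0%N ->
    \prod_j mutate_var k (Seed a y) j ^+ b j = \prod_j y j ^+ b j.
  move=> bk; apply: eq_bigr => j _; rewrite /mutate_var.
  by have [->|//] := eqVneq j k; rewrite bk !expr0.
rewrite -/(mutate_var k (Seed a y)) (E (mutate_arrows k a k)); last first.
  by rewrite /mutate_arrows eqxx.
rewrite (E (mutate_arrows k a ^~ k)); last by rewrite /mutate_arrows eqxx.
have -> : \prod_j y j ^+ mutate_arrows k a k j = \prod_j y j ^+ a j k.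
  by apply: eq_bigr => j _; rewrite /mutate_arrows eqxx.
have -> : \prod_j y j ^+ mutate_arrows k a j k = \prod_j y j ^+ a k j.
  by apply: eq_bigr => j _; rewrite /mutate_arrows eqxx orbT.
move: y'k; rewrite /mutate_var eqxx /= => y'k.
have {}y'k : \prod_j y j ^+ a k j + \prod_j y j ^+ a j k != 0.
  by apply: contraNneq y'k => ->; rewrite mul0r.
by rewrite addrC invf_div mulrCA divff // mulr1.
Qed.

Definition mutates (ks : seq V) (s : seed Q) : seed Q :=
  foldl (fun s k => mutate k s) s ks.

Lemma mutates_reachable ks s : all (fun k => ~~ frozen k) ks -> reachable s ->
  reachable (mutates ks s).
Proof.
elim: ks s => //= k ks IH s /andP[kN ksN] sR.
by apply: IH => //; apply: reachable_mutate.
Qed.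

(** * Values of rational functions at a point *)

Section Evaluation.
Variables (E : fieldType) (c : V -> E).

(** Coefficients are integers so that evaluation makes sense in any characteristic, in particular in
    a finite field. *)
Definition int_eval (p : {mpoly int[#|V|]}) : E :=
  meval (fun i => c (enum_val i)) (map_mpoly intr p).

Definition int_frac (p : {mpoly int[#|V|]}) : K :=
  FracField.tofrac (map_mpoly intr p).

(* The elements w of Q(x_v) that are regular at c with value e. *)
Definition evaluates (w : K) (e : E) := exists p q : {mpoly int[#|V|]},
  [/\ int_eval q != 0, w = int_frac p / int_frac q & e = int_eval p / int_eval q].

Lemma int_evalB p q : int_eval (p - q) = int_eval p - int_eval q.
Proof. by rewrite /int_eval !rmorphB. Qed.

Lemma int_evalM p q : int_eval (p * q) = int_eval p * int_eval q.
Proof. by rewrite /int_eval !rmorphM. Qed.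

Lemma int_eval1 : int_eval 1 = 1.
Proof. by rewrite /int_eval !rmorph1. Qed.

Lemma int_fracB p q : int_frac (p - q) = int_frac p - int_frac q.
Proof. by rewrite /int_frac !rmorphB. Qed.

Lemma int_fracM p q : int_frac (p * q) = int_frac p * int_frac q.
Proof. by rewrite /int_frac !rmorphM. Qed.

Lemma int_frac1 : int_frac 1 = 1.
Proof. by rewrite /int_frac !rmorph1. Qed.

Lemma int_frac_eq0 p : (int_frac p == 0) = (p == 0).
Proof.
rewrite /int_frac tofrac_eq0; apply/eqP/eqP => [/mpolyP h|->]; last exact: raddf0.
apply/mpolyP => m; have := h m; rewrite mcoeff_map_mpoly !mcoeff0 => /eqP.
by rewrite intr_eq0 => /eqP.
Qed.

Lemma int_frac_neq0 q : int_eval q != 0 -> int_frac q != 0.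
Proof.
by rewrite int_frac_eq0; apply: contraNneq => ->; rewrite /int_eval !raddf0.
Qed.

Lemma evaluates_fun w e e' : evaluates w e -> evaluates w e' -> e = e'.
Proof.
move=> [p [q [q0 -> ->]]] [p' [q' [q'0 /eqP h ->]]]; apply/eqP; move: h.
rewrite (eqr_div _ _ (int_frac_neq0 q0) (int_frac_neq0 q'0)) (eqr_div _ _ q0 q'0).
rewrite -2!int_fracM -2!int_evalM -subr_eq0 -int_fracB int_frac_eq0 subr_eq0.
by move=> /eqP->.
Qed.

Lemma evaluatesB w w' e e' : evaluates w e -> evaluates w' e' ->
  evaluates (w - w') (e - e').
Proof.
move=> [p [q [q0 -> ->]]] [p' [q' [q'0 -> ->]]]; exists (p * q' - p' * q), (q * q').
split; first by rewrite int_evalM mulf_neq0.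
  rewrite int_fracB (int_fracM p) (int_fracM p') (int_fracM q) -mulNr.
  by rewrite (addf_div _ _ (int_frac_neq0 q0) (int_frac_neq0 q'0)) mulNr.
by rewrite int_evalB !int_evalM -mulNr (addf_div _ _ q0 q'0) mulNr.
Qed.

Lemma evaluatesM w w' e e' : evaluates w e -> evaluates w' e' ->
  evaluates (w * w') (e * e').
Proof.
move=> [p [q [q0 -> ->]]] [p' [q' [q'0 -> ->]]]; exists (p * p'), (q * q').
split; first by rewrite int_evalM mulf_neq0.
  by rewrite (int_fracM p) (int_fracM q); apply: mulf_div.
by rewrite !int_evalM; apply: mulf_div.
Qed.

Lemma evaluates1 : evaluates 1 1.
Proof.
by exists 1, 1; rewrite int_eval1 int_frac1 !divr1 oner_neq0.
Qed.

Lemma evaluatesV w e : e != 0 -> evaluates w e -> evaluates w^-1 e^-1.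
Proof.
move=> e0 [p [q [q0 wE eE]]]; exists q, p; split.
- by apply: contraNneq e0; rewrite eE => ->; rewrite mul0r.
- by rewrite wE; apply: invf_div.
by rewrite eE; apply: invf_div.
Qed.

Lemma evaluates_var v : evaluates (FracField.tofrac 'X_(enum_rank v)) (c v).
Proof.
exists 'X_(enum_rank v), 1; rewrite int_eval1 int_frac1 !divr1 oner_neq0.
by rewrite /int_frac /int_eval !map_mpolyX mevalXU enum_rankK.
Qed.

End Evaluation.

(** * Partially defined morphisms, as relations compatible with the ring operations *)

Section PartialMorphism.
Variables (E : fieldType) (ev : K -> E -> Prop).
Hypothesis ev1 : ev 1 1.
Hypothesis evB : forall w w' e e', ev w e -> ev w' e' -> ev (w - w') (e - e').
Hypothesis evM : forall w w' e e', ev w e -> ev w' e' -> ev (w * w') (e * e').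
Hypothesis evV : forall w e, e != 0 -> ev w e -> ev w^-1 e^-1.

Lemma ev0 : ev 0 0. Proof. by have := evB ev1 ev1; rewrite !subrr. Qed.

Lemma evD w w' e e' : ev w e -> ev w' e' -> ev (w + w') (e + e').
Proof.
move=> h h'; have := evB h (evB ev0 h').
by rewrite !sub0r !opprK.
Qed.

Lemma evX w e n : ev w e -> ev (w ^+ n) (e ^+ n).
Proof. by move=> h; elim: n => [|n IH]; rewrite ?expr0 // !exprS; apply: evM. Qed.

Lemma ev_prod (y : V -> K) (z : V -> E) (a : V -> nat) :
  (forall v, ev (y v) (z v)) -> ev (\prod_v y v ^+ a v) (\prod_v z v ^+ a v).
Proof.
move=> h; elim/big_rec2: _ => // v w w' _ IH.
by apply: evM => //; apply: evX.
Qed.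

Definition mutate_val k (a : V -> V -> nat) (z : V -> E) v :=
  if v == k then (\prod_j z j ^+ a k j + \prod_i z i ^+ a i k) / z k else z v.

Lemma ev_mutate k s z : z k != 0 -> (forall v, ev (seed_var s v) (z v)) ->
  forall v, ev (seed_var (mutate k s) v) (mutate_val k (seed_arrows s) z v).
Proof.
move=> zk h v; rewrite /= /mutate_var /mutate_val; case: ifP => // _.
apply: evM; last exact: evV.
by apply: evD; apply: ev_prod.
Qed.

End PartialMorphism.

(** Exchange relations are free of subtraction, so positivity at a rational point survives mutation
    and keeps all denominators nonzero. *)
Definition positive_at (c : V -> rat) (w : K) := exists2 r, 0 < r & evaluates c w r.

Lemma positive_neq0 c w : positive_at c w -> w != 0.
Proof.
case=> r r0 h; apply: contraTneq r0 => w0; rewrite w0 in h.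
have h0 := ev0 (evaluates1 c) (@evaluatesB _ c).
by rewrite (evaluates_fun h h0) ltxx.
Qed.

Definition positive_seed c s := forall v, positive_at c (seed_var s v).

Lemma positive_mutate c k s : positive_seed c s -> positive_seed c (mutate k s).
Proof.
move=> h; have [z z0 hz] : exists2 z : V -> rat, forall v, 0 < z v &
    forall v, evaluates c (seed_var s v) (z v).
  have [z hz] := choice (fun v => let: ex_intro2 r r0 rh := h v in
    ex_intro (fun r => 0 < r /\ evaluates c (seed_var s v) r) r (conj r0 rh)).
  by exists z => v; case: (hz v).
have zk : z k != 0 by rewrite gt_eqF.
move=> v; exists (mutate_val k (seed_arrows s) z v); last first.
  apply: (ev_mutate (evaluates1 c) (@evaluatesB _ c) (@evaluatesM _ c)) => //.
  exact: evaluatesV.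
rewrite /mutate_val; case: ifP => // _.
by rewrite divr_gt0 // addr_gt0 // prodr_gt0 // => j _; rewrite exprn_gt0.
Qed.

Lemma positive_initial : positive_seed (fun=> 1) (initial_seed Q).
Proof. by move=> v; exists 1 => //; apply: evaluates_var. Qed.

Lemma positive_reachable s : reachable s -> positive_seed (fun=> 1) s.
Proof.
elim=> [|k s0 _ _]; [exact: positive_initial | exact: positive_mutate].
Qed.

Lemma mutates_rev c ks s : all (fun k => ~~ frozen k) ks ->
  cancelled (seed_arrows s) -> positive_seed c s ->
  [/\ cancelled (seed_arrows (mutates ks s)), positive_seed c (mutates ks s) &
      mutates (rev ks) (mutates ks s) = s].
Proof.
elim: ks s => //= k ks IH s /andP[kN ksN] sC sP.
have s'C := mutate_arrows_cancelled kN sC; have s'P := positive_mutate k sP.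
have [h1 h2 h3] := IH (mutate k s) ksN s'C s'P; split=> //.
rewrite rev_cons /mutates foldl_rcons -/(mutates (rev ks) _) h3.
by apply: mutateK => //; [exact: positive_neq0 (sP k) | exact: positive_neq0 (s'P k)].
Qed.

(** Here [c] substitutes elements of the ambient field for its variables. Substitution commutes with
    mutation as long as no denominator vanishes, which positivity of [s'] at the rational point [E]
    ensures. *)
Lemma ev_mutates E c ks s s' : all (fun k => ~~ frozen k) ks ->
  seed_arrows s = seed_arrows s' -> positive_seed E s' ->
  (forall v, evaluates c (seed_var s v) (seed_var s' v)) ->
  forall v, evaluates c (seed_var (mutates ks s) v) (seed_var (mutates ks s') v).
Proof.
elim: ks s s' => //= k ks IH s s' /andP[kN ksN] sE s'P h.
apply: IH => //; [by rewrite /= sE | exact: positive_mutate |].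
move=> v; have s'k := positive_neq0 (s'P k).
have := ev_mutate (evaluates1 c) (@evaluatesB _ c) (@evaluatesM _ c) (@evaluatesV _ c)
  s'k h v.
by rewrite /mutate_val /= /mutate_var sE.
Qed.

End Seeds.

(** * Local systems *)

Section Framings.
Variables (D V : finType) (ar : D -> V) (opp : D -> D).
Hypothesis oppK : involutive opp.
Hypothesis ar_opp : forall x, ar (opp x) = ar x.
Hypothesis ar_eq : forall x y, ar x = ar y -> y = x \/ y = opp x.

Variables (K : fieldType) (W : K -> Prop).
Hypothesis W1 : W 1%R.
Hypothesis WB : forall x y, W x -> W y -> W (x - y)%R.
Hypothesis WM : forall x y, W x -> W y -> W (x * y)%R.

Local Open Scope ring_scope.

Lemma W0 : W 0. Proof. by rewrite -(subrr 1); apply: WB. Qed.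
Lemma WN x : W x -> W (- x). Proof. by rewrite -sub0r; apply: WB; exact: W0. Qed.
Lemma WD x y : W x -> W y -> W (x + y).
Proof. by move=> wx wy; rewrite -(opprK y); apply: WB => //; apply: WN. Qed.

Definition det2 (u v : K * K) : K := u.1 * v.2 - u.2 * v.1.

(* A 2x2 matrix is the pair of its columns. *)
Definition app2 (g : (K * K) * (K * K)) (v : K * K) : K * K :=
  (g.1.1 * v.1 + g.2.1 * v.2, g.1.2 * v.1 + g.2.2 * v.2).
Definition adj2 (g : (K * K) * (K * K)) : (K * K) * (K * K) :=
  ((g.2.2, - g.1.2), (- g.2.1, g.1.1)).

Definition W2 (v : K * K) := W v.1 /\ W v.2.
Definition W22 (g : (K * K) * (K * K)) := W2 g.1 /\ W2 g.2.

Lemma det2_app g u v : det2 (app2 g u) (app2 g v) = det2 g.1 g.2 * det2 u v.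
Proof. by rewrite /det2 /app2 /=; ring. Qed.

Lemma app2_comp g h v : app2 (app2 g h.1, app2 g h.2) v = app2 g (app2 h v).
Proof. by rewrite /app2 /=; congr (_, _); ring. Qed.

Lemma app2_adj g v : det2 g.1 g.2 = 1 -> app2 (adj2 g) (app2 g v) = v.
Proof.
by case: v => a b h; rewrite /app2 /=; congr (_, _);
  [rewrite -[RHS]mul1r -h | rewrite -[RHS]mul1r -h]; rewrite /det2; ring.
Qed.

Lemma pairNE (v : K * K) : ((- v).1 = - v.1) * ((- v).2 = - v.2).
Proof. by []. Qed.

Lemma pairN v w : v.1 = - w.1 -> v.2 = - w.2 -> v = - w :> K * K.
Proof. by case: v w => [v1 v2] [w1 w2] /= -> ->. Qed.

Lemma app2N g v : app2 g (- v) = - app2 g v.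
Proof. by apply: pairN; rewrite /app2 !pairNE /=; ring. Qed.

Lemma W2_app g v : W22 g -> W2 v -> W2 (app2 g v).
Proof. by move=> [[? ?] [? ?]] [? ?]; split; apply: WD; apply: WM. Qed.

Lemma W2N v : W2 v -> W2 (- v).
Proof. by case=> ? ?; split; apply: WN. Qed.

(* A decorated twisted SL2-local system with entries in W.  The vectors u x,
   u (nx x), u (nx (nx x)) sit at the corners of the triangle of x, in a frame
   attached to this triangle, and g x changes this frame into the frame of the
   triangle of opp x; the sign makes both sides of an arc have the same
   lambda-length y. *)
Definition framed (nx : D -> D) (y : V -> K) :=
  exists (u : D -> K * K) (g : D -> (K * K) * (K * K)),
  [/\ forall x, W2 (u x), forall x, W22 (g x),
      forall x, det2 (u x) (u (nx x)) = y (ar x) &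
      forall x, opp x != x -> app2 (g x) (u x) = u (nx (opp x)) /\
                              app2 (g x) (u (nx x)) = - u (opp x)].

Lemma framed_in nx y x : framed nx y -> W (y (ar x)).
Proof.
by move=> [u [g [uW _ <- _]]]; apply: WB; apply: WM;
  [case: (uW x) | case: (uW (nx x)) | case: (uW x) | case: (uW (nx x))].
Qed.

(** All vectors of the quadrilateral are brought into the frame of the triangle of [d], which then
    serves both new triangles; the exchange relation becomes the Plücker relation between the four
    corner vectors. *)
Lemma flip_framed nx d y y' : triangular nx -> unpunctured opp nx -> opp d != d ->
  y (ar d) != 0 -> (forall v, v != ar d -> y' v = y v) ->
  y' (ar d) = (y (ar (nx d)) * y (ar (nx (opp d))) +
     y (ar (nx (nx d))) * y (ar (nx (nx (opp d))))) / y (ar d) ->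
  framed nx y -> framed (flip opp nx d) y'.
Proof.
move=> nx3 nxP dN yd y'E y'd [u [g [uW gW uD uG]]].
have [[f1 f2 f3] [f4 f5 f6]] := flip_in oppK nx3 nxP dN.
have := quad_uniq oppK nx3 nxP dN; rewrite /= !inE !negb_or.
case/and5P=> /and5P[a1 a2 a3 a4 a5] /and4P[b1 b2 b3 b4] /and3P[c1 c2 c3].
move=> /andP[e1 e2] /andP[g1 _].
set d' := opp d in a3 a4 a5 b2 b3 b4 c1 c2 c3 e1 e2 g1 f2 f3 f4 f5 f6 *.
set a := nx d in a1 a2 a4 a5 b1 b2 b3 b4 c1 c2 c3 e1 e2 g1 f2 f3 f4 f5 f6 f1 y'd.
set b := nx a in a2 b1 c1 c2 c3 f1 f2 y'd.
set c := nx d' in a4 b3 c2 e1 g1 f2 f3 f4 f5 a5 b4 c3 e2 y'd.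
set e := nx c in a5 b4 c3 e2 g1 f4 f5 y'd.
have d'N : opp d' != d' by rewrite oppK eq_sym.
have [Gd' Gc] := uG _ d'N; rewrite oppK -/a -/c in Gd' Gc.
set G := g d' in Gd' Gc.
have nb : nx b = d by exact: nx3.1.
have ne : nx e = d' by exact: nx3.1.
have dd' : det2 (u d') (u c) = y (ar d) by rewrite uD ar_opp.
(* Both sides of the diagonal have the same nonzero length, so [G] has determinant one. *)
have detG : det2 G.1 G.2 = 1.
  apply: (mulIf yd); rewrite -{1}dd' -det2_app Gd' Gc mul1r -uD -/a /det2 !pairNE; ring.
have ndb : d != b by rewrite a2.
(* [h] moves the darts [c] and [e] into the frame of the triangle of [d]. The sign at [c] undoes the
   one in [Gc], so that [c] receives the vector [u d]. *)
pose h x := if x == c then (- G.1, - G.2) else if x == e then G else ((1, 0), (0, 1)).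
have hD x : det2 (h x).1 (h x).2 = 1.
  rewrite /h; case: ifP => _; first by rewrite -detG /det2 /=; ring.
  by case: ifP => _ //; rewrite /det2 /=; ring.
have h1 v : app2 ((1, 0), (0, 1)) v = v.
  by case: v => p q; rewrite /app2 /=; congr (_, _); ring.
have hN v : app2 (- G.1, - G.2) v = - app2 G v.
  by apply: pairN; rewrite /app2 !pairNE /=; ring.
have hW x : W22 (h x).
  rewrite /h; case: ifP => _; first by case: (gW d') => ? ?; split; apply: W2N.
  case: ifP => _; first exact: gW.
  by split; split => //=; exact: W0.
have hW' x : W22 (adj2 (h x)).
  by case: (hW x) => [[? ?] [? ?]]; split; split => //=; apply: WN.
pose u' x := if x == d then - app2 G (u e) else if x == d' then u b else
  app2 (h x) (u x).
have u'E x : x != d -> x != d' -> u' x = app2 (h x) (u x).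
  by move=> /negbTE xd /negbTE xd'; rewrite /u' xd xd'.
have hc : h c = (- G.1, - G.2) by rewrite /h eqxx.
have he : h e = G by rewrite /h eqxx eq_sym (negbTE g1).
have ha : h a = ((1, 0), (0, 1)) by rewrite /h (negbTE b3) (negbTE b4).
have hb : h b = ((1, 0), (0, 1)) by rewrite /h (negbTE c2) (negbTE c3).
have u'd : u' d = - app2 G (u e) by rewrite /u' eqxx.
have u'd' : u' d' = u b by rewrite /u' eqxx eq_sym (negbTE a3).
have u'c : u' c = u d by rewrite u'E 1?eq_sym // hc hN Gc opprK.
have u'e : u' e = app2 G (u e) by rewrite u'E 1?eq_sym // he.
have u'a : u' a = u a by rewrite u'E 1?eq_sym // ?ha // eq_sym.
have u'b : u' b = u b by rewrite u'E // ?hb ?h1 // eq_sym.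
have u'nx x : x != d -> x != d' -> u' (flip opp nx d x) = app2 (h x) (u (nx x)).
  move: x; apply: (@quadP _ opp nx d); rewrite -/d' -/a -/b -/c -/e ?eqxx //.
  - by rewrite f6 u'd' ha h1.
  - by rewrite f2 u'c hb h1 nb.
  - by rewrite f3 u'd hc hN.
  - by rewrite f5 u'a he ne Gd'.
  move=> x xq _ _; have [-> nq] := flip_out nx3 xq.
  move: xq nq; rewrite !inE -/d' -/a -/b -/c -/e !negb_or.
  move=> /and5P[_ _ _ _ /andP[/negbTE xc /negbTE xe]].
  move=> /and5P[nd _ _ nd' /andP[/negbTE nxc /negbTE nxe]].
  by rewrite u'E // /h xc xe nxc nxe.
have plucker : det2 (- app2 G (u e)) (u b) = y' (ar d).
  rewrite y'd; apply: (mulIf yd); rewrite mulfVK // -!uD -/a -/b -/c -/e nb ne.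
  rewrite -[det2 (u c) _]mul1r -[det2 (u e) _]mul1r -detG -!det2_app Gd' Gc.
  by rewrite /det2 /=; ring.
(* Both new triangles share a frame, so crossing the new diagonal is the identity up to sign; the
   other transitions are composed with the changes of frame, inverted by [adj2], which preserves
   entries in [W]. *)
pose g' x := if x == d then ((-1, 0), (0, -1)) else if x == d' then ((1, 0), (0, 1))
  else (app2 (h (opp x)) (app2 (g x) (adj2 (h x)).1),
        app2 (h (opp x)) (app2 (g x) (adj2 (h x)).2)).
exists u', g'; split.
- move=> x; rewrite /u'; case: ifP => _; first by apply: W2N; apply: W2_app; [exact: gW | exact: uW].
  by case: ifP => _; [exact: uW | apply: W2_app; [exact: hW | exact: uW]].
- move=> x; rewrite /g'; case: ifP => _.
    by split; split => /=; rewrite -1?oppr0; do ?[exact: WN]; apply: WN => //; exact: W0.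
  case: ifP => _; first by split; split => //=; exact: W0.
  by case: (hW' x) => ? ?; split; do 2![apply: W2_app => //]; exact: gW.
- move=> x; have [->|xd] := eqVneq x d; first by rewrite f1 u'd u'b.
  have [->|xd'] := eqVneq x d'.
    by rewrite f4 u'd' u'e ar_opp -plucker /det2 /=; ring.
  rewrite u'nx // u'E // det2_app hD mul1r uD y'E //.
  by apply/eqP=> /esym/ar_eq[] /eqP; apply/negP.
move=> x xN; have [->|xd] := eqVneq x d.
  rewrite /g' eqxx -/d' f4 u'd f1 u'e u'd' u'b.
  by rewrite /app2 /=; split; congr (_, _) => /=; ring.
have [->|xd'] := eqVneq x d'.
  rewrite /g' eqxx eq_sym (negbTE a3) u'd' oppK f1 f4 u'e u'd u'b.
  by rewrite !h1 opprK.
have od : opp x != d by rewrite (can2_eq oppK oppK).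
have od' : opp x != d' by rewrite (inj_eq (can_inj oppK)).
have g'E v : app2 (g' x) v = app2 (h (opp x)) (app2 (g x) (app2 (adj2 (h x)) v)).
  by rewrite /g' (negbTE xd) (negbTE xd') -!app2_comp.
have [G1 G2] := uG _ xN.
by rewrite !g'E !u'nx // !u'E // !app2_adj // G1 G2 app2N.
Qed.

(* Placing the vectors of the boundary side of each triangle on the coordinate
   axes makes every coordinate of a transition matrix, up to the inverse of a
   boundary variable, a determinant between corners of two adjacent triangles,
   that is up to sign a side or one of the two diagonals of a quadrilateral. *)
Lemma framed_one_boundary_side nx y : triangular nx ->
  (forall x, [|| opp x == x, opp (nx x) == nx x | opp (nx (nx x)) == nx (nx x)]) ->
  (forall x, opp x == x -> opp (nx x) != nx x) ->
  (forall v, y v != 0) -> (forall v, W (y v)) ->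
  (forall x, opp x == x -> W (y (ar x))^-1) ->
  (forall x, opp x != x -> W ((y (ar (nx x)) * y (ar (nx (opp x))) +
     y (ar (nx (nx x))) * y (ar (nx (nx (opp x))))) / y (ar x))) ->
  framed nx y.
Proof.
move=> nx3 bd1 bd2 y0 yW yV yX; have nxK := nx3.1.
pose u x : K * K := if opp x == x then (1, 0) else
  if opp (nx (nx x)) == nx (nx x) then (0, y (ar (nx (nx x)))) else
  (- (y (ar (nx (nx x))) / y (ar (nx x))), - y (ar x)).
have ub x : opp x == x -> [/\ u x = (1, 0), u (nx x) = (0, y (ar x)) &
    u (nx (nx x)) = (- (y (ar (nx x)) / y (ar x)), - y (ar (nx (nx x))))].
  move=> xb; have n1 := bd2 _ xb.
  have n2 : opp (nx (nx x)) != nx (nx x).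
    by apply: contraL xb => /bd2; rewrite nxK.
  by rewrite /u xb (negbTE n1) (negbTE n2) !nxK xb (negbTE n1).
have cellP (R : D -> Prop) x : (forall z, opp z == z -> R z /\ R (nx z) /\ R (nx (nx z))) ->
    R x.
  move=> h; case/or3P: (bd1 x) => /h; first by case.
    by case=> _ []; rewrite nxK.
  by case=> _ []; rewrite nxK.
have uD x : det2 (u x) (u (nx x)) = y (ar x).
  apply: (cellP (fun x => det2 (u x) (u (nx x)) = y (ar x))) => z zb.
  have [u1 u2 u3] := ub _ zb; rewrite nxK u1 u2 u3 /det2 /=.
  by split; [|split]; field; rewrite ?y0.
have uW x : W2 (u x).
  apply: (cellP (fun x => W2 (u x))) => z zb.
  have [-> -> ->] := ub _ zb; split; [|split]; split => //=; try exact: W0.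
    by apply: WN; apply: WM => //; apply: yV.
  exact: WN.
(* Cramer's rule: the linear map sending the basis [u x], [u (nx x)] to the images prescribed for
   the transition matrix. *)
pose f x v : K * K :=
  let c := (det2 v (u (nx x)) / y (ar x), - (det2 (u x) v / y (ar x))) in
  app2 (u (nx (opp x)), u (opp x)) c.
have fE x v : app2 (f x (1, 0), f x (0, 1)) v = f x v.
  by rewrite /f /app2 /det2 /=; congr (_, _); ring.
have fu x : f x (u x) = u (nx (opp x)) /\ f x (u (nx x)) = - u (opp x).
  have e1 (v : K * K) : det2 v v = 0 by rewrite /det2 mulrC subrr.
  split; rewrite /f uD e1 mul0r divff //.
    by rewrite /app2 /= oppr0; case: (u _) => p q /=; congr (_, _); ring.
  by apply: pairN; rewrite /app2 /=; ring.
have fdet x v w : det2 (f x v) w = (det2 v (u (nx x)) / y (ar x)) * det2 (u (nx (opp x))) w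
    - (det2 (u x) v / y (ar x)) * det2 (u (opp x)) w.
  by rewrite /f /det2 /app2 /=; ring.
have bdP x : exists2 z, opp z == z &
    (z \in [:: x; nx x; nx (nx x)]) && (nx z \in [:: x; nx x; nx (nx x)]).
  have [h|h|h] := or3P (bd1 x); [exists x | exists (nx x) | exists (nx (nx x))];
    by rewrite // ?nxK !inE !eqxx ?orbT.
suff fW x z : opp x != x -> z \in [:: x; nx x; nx (nx x)] -> W2 (f x (u z)).
  exists u, (fun x => if opp x == x then ((1, 0), (0, 1)) else (f x (1, 0), f x (0, 1))).
  split=> // x; last by move=> /negbTE->; rewrite !fE.
  case: ifPn => [_|xN]; first by split; split => //=; exact: W0.
  have [z zb /andP[zx nzx]] := bdP x; have [u1 u2 _] := ub _ zb.
  split=> /=; first by rewrite -u1; apply: fW.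
  have -> : f x (0, 1) = ((f x (u (nx z))).1 / y (ar z), (f x (u (nx z))).2 / y (ar z)).
    rewrite u2 /f /app2 /det2 /=.
    by congr (_, _); field; rewrite !y0.
  by have [h1 h2] := fW _ _ xN nzx; split => /=; apply: WM => //; apply: yV.
(* The boundary side of the triangle of [opp x] has its vectors on the axes, so determinants against
   them read off the coordinates. *)
move=> xN zx; suff key z' : z' \in [:: opp x; nx (opp x); nx (nx (opp x))] ->
    W (det2 (f x (u z)) (u z')).
  have [t tb /andP[tx ntx]] := bdP (opp x); have [u1 u2 _] := ub _ tb.
  have := key _ tx; have := key _ ntx; rewrite u1 u2 /det2 /= !mulr0 subr0 sub0r mulr1.
  move=> h1 h2; split; last by rewrite -[X in W X]opprK; apply: WN.
  by rewrite -[X in W X](mulfK (y0 (ar t))); apply: WM => //; apply: yV.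
have anti p q : det2 p q = - det2 q p by rewrite /det2; ring.
have e1 (v : K * K) : det2 v v = 0 by rewrite /det2 mulrC subrr.
have dx' := uD (opp x); rewrite ar_opp in dx'.
have d2 := uD (nx (nx x)); rewrite nxK in d2.
have d2' := uD (nx (nx (opp x))); rewrite nxK in d2'.
have [fx fnx] := fu x.
(* Of the nine pairs of corners, only the last is joined by the other diagonal, whose length is the
   exchange quotient. *)
move: zx; rewrite !inE => /or3P[/eqP->|/eqP->|/eqP->] /or3P[/eqP->|/eqP->|/eqP->];
  rewrite ?fx ?fnx.
- by rewrite anti dx'; apply: WN.
- by rewrite e1; exact: W0.
- by rewrite uD.
- by rewrite /det2 !pairNE; have := e1 (u (opp x)); rewrite /det2 => e; 
    rewrite (_ : _ - _ = 0); [exact: W0 | rewrite -e; ring].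
- have -> : det2 (- u (opp x)) (u (nx (opp x))) = - det2 (u (opp x)) (u (nx (opp x))).
    by rewrite /det2 !pairNE; ring.
  by rewrite dx'; apply: WN.
- have -> : det2 (- u (opp x)) (u (nx (nx (opp x)))) = y (ar (nx (nx (opp x)))).
    by rewrite -d2' /det2 !pairNE; ring.
  exact: yW.
- rewrite fdet e1 mulr0 subr0 (anti (u (nx (opp x)))) dx' (anti (u (nx (nx x)))) uD.
  by rewrite mulNr mulrNN divfK.
- by rewrite fdet e1 mulr0 sub0r dx' (anti (u x)) d2 mulNr mulNr opprK divfK.
- rewrite fdet uD (anti (u (opp x))) d2' (anti (u x)) d2 (anti (u (nx (nx x)))) uD.
  rewrite (_ : _ - _ = - ((y (ar (nx x)) * y (ar (nx (opp x))) +
   y (ar (nx (nx x))) * y (ar (nx (nx (opp x))))) / y (ar x))); last by ring.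
  by apply: WN; apply: yX.
Qed.

End Framings.

(** * Colourings *)

Section Colouring.
Variables (D : finType) (Q : ice_quiver) (ar : D -> vertex Q) (opp : D -> D).
Hypothesis oppK : involutive opp.
Hypothesis ar_opp : forall x, ar (opp x) = ar x.
Hypothesis ar_eq : forall x y, ar x = ar y -> y = x \/ y = opp x.
Hypothesis frozen_ar : forall x, frozen (ar x) = (opp x == x).

(* Intended reading: c x is the boundary component containing the start of x. *)
Definition colouring (nx : D -> D) (c : D -> bool) := forall x, c (nx (opp x)) = c x.

Definition mixed (nx : D -> D) (c : D -> bool) (x : D) :=
  ~~ ((c (nx x) == c x) && (c (nx (nx x)) == c x)).

(** Both ends of the diagonal have the colour of the one-coloured triangle, so the facing corner of
    the mixed triangle has the other colour. The new diagonal is thus two-coloured, and it is a side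
    of both new triangles. *)
Lemma flip_colouring nx c d : triangular nx -> unpunctured opp nx -> opp d != d ->
  colouring nx c -> mixed nx c d -> ~~ mixed nx c (opp d) ->
  exists c', [/\ colouring (flip opp nx d) c', mixed (flip opp nx d) c' d &
    #|[pred x | ~~ mixed (flip opp nx d) c' x]| < #|[pred x | ~~ mixed nx c x]|].
Proof.
move=> nx3 nxP dN cP md; rewrite negbK => /andP[/eqP ce /eqP cf].
have [[f1 f2 f3] [f4 f5 f6]] := flip_in oppK nx3 nxP dN.
have := quad_uniq oppK nx3 nxP dN; rewrite /= !inE !negb_or.
case/and5P=> /and5P[a1 a2 a3 a4 a5] /and4P[b1 b2 b3 b4] /and3P[c1 c2 c3].
move=> /andP[e1 e2] /andP[g1 _].
have cd : c (nx (opp d)) = c d by [].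
have ca : c (nx d) = c (opp d) by rewrite -(cP (opp d)) oppK.
pose c' x := if x == d then c (nx (nx (opp d))) else
  if x == opp d then c (nx (nx d)) else c x.
have c'E x : x != d -> x != opp d -> c' x = c x.
  by rewrite /c' => /negbTE-> /negbTE->.
have c'd : c' d = c d by rewrite /c' eqxx cf -ce cd.
have c'd' : c' (opp d) = c (nx (nx d)) by rewrite /c' (negbTE dN) eqxx.
have [c'a c'b c'c c'e] : [/\ c' (nx d) = c d, c' (nx (nx d)) = c (nx (nx d)),
    c' (nx (opp d)) = c d & c' (nx (nx (opp d))) = c d].
  split; rewrite c'E //; rewrite ?ca ?cf -?ce //; try by rewrite eq_sym.
have cb : c (nx (nx d)) != c d.
  by move: md; rewrite /mixed ca -ce cd eqxx.
have m' x : x \in quadrilateral opp nx d -> mixed (flip opp nx d) c' x.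
  rewrite !inE => /or4P[/eqP->|/eqP->|/eqP->|/or3P[/eqP->|/eqP->|/eqP->]];
    rewrite /mixed ?(f1, f2, f3, f4, f5, f6) ?c'd ?c'd' ?c'a ?c'b ?c'c ?c'e;
    by rewrite ?eqxx ?andbT ?(eq_sym (c d)) ?(negbTE cb) ?andbF.
exists c'; split.
- suff H y : c' (flip opp nx d y) = c' (opp y) by move=> x; rewrite H oppK.
  have oy y' : y' != opp d -> y' != d -> c' (opp y') = c (nx y').
    move=> h1 h2; rewrite -(oppK y') cP oppK c'E // ?(inj_eq (can_inj oppK)) //.
    by rewrite (can2_eq oppK oppK).
  move: y; apply: (@quadP _ opp nx d).
  + by rewrite f1 c'b c'd'.
  + by rewrite f6 c'd' oy // eq_sym.
  + by rewrite f2 c'c oy ?nx3.1 // eq_sym.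
  + by rewrite f4 c'e oppK c'd.
  + by rewrite f3 c'd oy ?cf -?ce // eq_sym.
  + by rewrite f5 c'a oy ?nx3.1 -?ce // eq_sym.
  move=> y yq; have [-> nq] := flip_out nx3 yq.
  move: yq nq; rewrite !inE !negb_or.
  move=> /and5P[yd _ _ yd' _] /and5P[nd _ _ nd' _].
  by rewrite c'E // oy.
- by apply: m'; rewrite inE eqxx.
apply: proper_card; apply/properP; split.
  apply/fintype.subsetP => x; rewrite !inE => h.
  have xq : x \notin quadrilateral opp nx d by apply: contra h => /m'.
  have [E1 nq] := flip_out nx3 xq; have [E2 nnq] := flip_out nx3 nq.
  move: h; rewrite /mixed E1 E2; move: xq nq nnq; rewrite !inE !negb_or.
  move=> /and5P[xd _ _ xd' _] /and5P[nd _ _ nd' _] /and5P[nnd _ _ nnd' _].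
  by rewrite !c'E.
exists (opp d); rewrite !inE; first by rewrite negbK /mixed ce cf !eqxx.
by rewrite negbK; apply: m'; rewrite !inE eqxx !orbT.
Qed.

Lemma reduce_to_mixed nx c : triangular nx -> unpunctured opp nx ->
  transitive_on_darts opp nx -> colouring nx c -> (exists x, mixed nx c x) ->
  exists ks nx' c', [/\ all (fun k => ~~ frozen k) ks,
    dart_arrows ar nx' = foldl (fun a k => mutate_arrows k a) (dart_arrows ar nx) ks,
    triangular nx', unpunctured opp nx' & transitive_on_darts opp nx'] /\
    (colouring nx' c' /\ forall x, mixed nx' c' x).
Proof.
have [N] := ubnP #|[pred x | ~~ mixed nx c x]|.
elim: N nx c => // N IH nx c leN nx3 nxP nxT cP [x0 mx0].
have [/forallP allm|/forallPn[z zN]] := boolP [forall x, mixed nx c x].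
  by exists [::], nx, c.
have mn x : mixed nx c x -> mixed nx c (nx x).
  rewrite /mixed nx3.1.
  by case: (c x) (c (nx x)) (c (nx (nx x))) => [] [] [].
(* Otherwise the mixed darts would be stable under [nx] and [opp], hence all darts would be mixed by
   connectedness. *)
have [d /andP[md md']] : exists d, mixed nx c d && ~~ mixed nx c (opp d).
  apply/existsP; apply: contraNT zN => /existsPn H.
  apply: (nxT (mixed nx c)) => //; first by exists x0.
  by move=> x mx; have := H x; rewrite mx negbK.
have dN : opp d != d by apply: contraNneq md' => ->.
have [c' [cP' mxd lt]] := flip_colouring nx3 nxP dN cP md md'.
have [|||||ks [nx' [c'' [[h1 h2 h3 h4 h5] h6]]]] := IH _ c' (leq_trans lt leN).
- exact: flip_triangular.
- exact: flip_unpunctured.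
- exact: flip_transitive.
- exact: cP'.
- by exists d.
exists (ar d :: ks), nx', c''; split=> //; split=> //=.
  by rewrite frozen_ar dN.
by rewrite h2 flip_arrows.
Qed.

End Colouring.

(** * Triangulations by bridging arcs *)

Section Bridging.
Variables (D V : finType) (ar : D -> V) (opp : D -> D).
Hypothesis oppK : involutive opp.
Hypothesis ar_opp : forall x, ar (opp x) = ar x.
Hypothesis ar_eq : forall x y, ar x = ar y -> y = x \/ y = opp x.
Hypothesis ar_surj : forall v, exists x, ar x = v.

Variables (nx : D -> D) (c : D -> bool).
Hypotheses (nx3 : triangular nx) (nxP : unpunctured opp nx).
Hypotheses (nxT : transitive_on_darts opp nx).
Hypotheses (cP : colouring opp nx c) (cM : forall x, mixed nx c x).
Hypothesis euler : (2 * #|D| <= 3 * #|V|)%N.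
Hypothesis D0 : exists x : D, true.

(** Fixing the direction from [true] to [false] selects exactly one dart in each mixed triangle, and
    one of the two darts of each bridging arc. *)
Definition bridge x := c x && ~~ c (nx x).
Definition mono x := c x == c (nx x).

Let nxK x : nx (nx (nx x)) = x. Proof. exact: nx3.1. Qed.

Let c_opp x : c (opp x) = c (nx x).
Proof. by rewrite -(cP (opp x)) oppK. Qed.

Let c_nx_opp x : c (nx (opp x)) = c x. Proof. exact: cP. Qed.

Lemma bridge_opp x : bridge x -> opp x != x.
Proof.
by case/andP=> h1 h2; apply/eqP=> e; move: h2; rewrite -c_opp e h1.
Qed.

Let cell_cases x :
  ((bridge x + bridge (nx x) + bridge (nx (nx x)))%N == 1%N) &&
  ((mono x + mono (nx x) + mono (nx (nx x)))%N == 1%N).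
Proof.
have := cM x; rewrite /mixed /bridge /mono nxK.
by case: (c x) (c (nx x)) (c (nx (nx x))) => [] [] [].
Qed.

Let card_cell (P : pred D) :
  (forall x, (P x + P (nx x) + P (nx (nx x)))%N = 1%N) -> #|D| = (3 * #|P|)%N.
Proof.
move=> h; have inj := triangular_inj nx3.
have E : \sum_x (P x : nat) = #|P|.
  rewrite -sum1_card [RHS]big_mkcond; apply: eq_bigr => x _.
  by rewrite unfold_in; case: (P x).
have E1 : \sum_x (P (nx x) : nat) = #|P| by rewrite -E [RHS](reindex_inj inj).
have E2 : \sum_x (P (nx (nx x)) : nat) = #|P|.
  by rewrite -E1 [RHS](reindex_inj inj).
have : \sum_x (P x + P (nx x) + P (nx (nx x)))%N = #|D|.
  by rewrite (eq_bigr (fun=> 1%N)) ?sum1_card // => x _; rewrite h.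
by rewrite !big_split /= E E1 E2 => <-; rewrite !mulSn mul0n addn0 addnA.
Qed.

Lemma card_bridge : #|D| = (3 * #|bridge|)%N.
Proof. by apply: card_cell => x; case/andP: (cell_cases x) => /eqP. Qed.

Lemma card_mono : #|D| = (3 * #|mono|)%N.
Proof. by apply: card_cell => x; case/andP: (cell_cases x) => _ /eqP. Qed.

Lemma arcs_cover : [set: V] = ar @: bridge :|: ar @: mono.
Proof.
apply/setP=> v; rewrite !inE; case: (ar_surj v) => x <-; symmetry; apply/orP.
have [m|] := boolP (mono x); first by right; apply: imset_f.
rewrite /mono; case cx: (c x); case cnx: (c (nx x)) => // _; left.
  by apply: imset_f; rewrite unfold_in /bridge cx cnx.
by rewrite -ar_opp; apply: imset_f; rewrite unfold_in /bridge c_opp c_nx_opp cx cnx.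
Qed.

(** Each triangle has one bridging and one one-coloured dart, and these cover all arcs: at most two
    arcs per triangle. As [euler] gives at least two, no two of these darts share an arc. *)
Lemma mono_boundary : {in mono &, injective ar} /\ #|V| = (2 * #|bridge|)%N.
Proof.
have h1 : #|ar @: bridge| <= #|bridge| by apply: leq_imset_card.
have h2 : #|ar @: mono| <= #|mono| by apply: leq_imset_card.
have h3 : #|V| <= #|ar @: bridge| + #|ar @: mono|.
  by rewrite -cardsT arcs_cover cardsU leq_subr.
have := card_bridge; have := card_mono; move: euler => h4 h5 h6.
split; last by lia.
have h : #|mono| <= #|ar @: mono| by lia.
by apply/imset_injP; rewrite eqn_leq leq_imset_card; apply: h.
Qed.

Lemma opp_mono x : mono x = (opp x == x).
Proof.
apply/idP/eqP => [mx|e]; last by rewrite /mono -c_opp e.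
have mo : mono (opp x) by rewrite /mono c_opp c_nx_opp eq_sym.
by apply: mono_boundary.1.
Qed.

(** Crosses the arc of [x] and leaves the neighbouring triangle by its other two-coloured side. The
    identity elsewhere makes it a permutation of all darts. *)
Definition next_bridge x := if bridge x then
  (if c (nx (nx (opp x))) then nx (nx (opp x)) else nx (opp x)) else x.

Lemma next_bridge_bridge x : bridge x -> bridge (next_bridge x).
Proof.
rewrite /next_bridge => bx; rewrite bx; case/andP: bx => cx cnx.
by case: ifP => h; rewrite /bridge ?nxK ?c_opp ?c_nx_opp ?h ?cx ?cnx.
Qed.

Let prev x := if c (nx (nx x)) then opp (nx x) else opp (nx (nx x)).

Let prevK x : bridge x -> prev (next_bridge x) = x.
Proof.
rewrite /next_bridge => bx; rewrite bx; case/andP: bx => cx cnx.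
by case h: (c (nx (nx (opp x)))); rewrite /prev !nxK ?c_nx_opp ?cx ?c_opp ?(negbTE cnx) oppK.
Qed.

Lemma next_bridge_inj : injective next_bridge.
Proof.
move=> x y; case bx: (bridge x); case by_: (bridge y) => e.
- by rewrite -(prevK bx) e prevK.
- by have := next_bridge_bridge bx; rewrite e /next_bridge by_ by_.
- by have := next_bridge_bridge by_; rewrite -e /next_bridge bx bx.
- by move: e; rewrite /next_bridge bx by_.
Qed.

Lemma exists_bridge : exists x, bridge x.
Proof.
case: D0 => x _; case/andP: (cell_cases x) => h _; move: h.
case b1: (bridge x); first by exists x.
case b2: (bridge (nx x)); first by exists (nx x).
by case b3: (bridge _) => // _; exists (nx (nx x)).
Qed.

Variable d0 : D.
Hypothesis d0b : bridge d0.

Definition nth_bridge k := iter k next_bridge d0.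

Lemma nth_bridgeP k : bridge (nth_bridge k).
Proof. by elim: k => //= k; apply: next_bridge_bridge. Qed.

(** The darts whose triangle has its bridging dart in the orbit of [d0] are stable under [nx] and
    [opp], hence all darts by connectedness. *)
Lemma fconnect_bridge x : bridge x -> fconnect next_bridge d0 x.
Proof.
pose O := fconnect next_bridge d0; move=> bx.
have sym := fconnect_sym next_bridge_inj.
have Ob y : O y -> bridge y.
  by move=> h; rewrite -(iter_findex h); apply: nth_bridgeP.
have On y : bridge y -> O (next_bridge y) = O y.
  by move=> _; rewrite /O; rewrite (same_connect_r sym (fconnect1 next_bridge y)).
pose S y := [|| O y, O (nx y) | O (nx (nx y))].
have Sn y : S (nx y) = S y by rewrite /S nxK orbA orbC.
have : S x.
  apply: (nxT (S := S)) => [|y|y].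
  - by exists d0; rewrite /S /O connect0.
  - by rewrite Sn.
  move=> Sy; have [m|] := boolP (mono y).
    by move: m; rewrite opp_mono => /eqP->.
  rewrite /mono; case cy: (c y); case cny: (c (nx y)) => // _.
    have b : bridge y by rewrite /bridge cy cny.
    have Oy : O y.
      case/or3P: Sy => // /Ob; rewrite /bridge ?nxK ?cy ?cny //.
      by rewrite andbF.
    have := On _ b; rewrite Oy /next_bridge b /S.
    by case: ifP => _ ->; rewrite ?orbT.
  have b : bridge (opp y) by rewrite /bridge c_opp c_nx_opp cy cny.
  have := On _ b; rewrite /S => <-; rewrite /next_bridge b oppK.
  case/or3P: Sy => h; have := Ob _ h; rewrite /bridge ?nxK ?cny ?cy ?andbF //.
    by move=> /andP[_ /negbTE ->]; rewrite h.
  by move=> /andP[-> _]; rewrite h.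
case/andP: bx => cx /negbTE cnx.
by case/or3P=> // /Ob; rewrite /bridge ?nxK ?cx ?cnx ?andbF.
Qed.

(** * Cyclic enumeration of the bridging arcs *)

Definition nb_bridges := order next_bridge d0.

Lemma nb_bridgesE : nb_bridges = #|bridge|.
Proof.
apply: eq_card => x; rewrite !unfold_in; apply/idP/idP => [h|]; last exact: fconnect_bridge.
by rewrite -(iter_findex h); apply: nth_bridgeP.
Qed.

Lemma nth_bridge_periodic k : nth_bridge (k + nb_bridges) = nth_bridge k.
Proof. by rewrite /nth_bridge iterD iter_order //; apply: next_bridge_inj. Qed.

Lemma nth_bridge_surj x : bridge x -> exists2 k, k < nb_bridges & x = nth_bridge k.
Proof.
move=> /fconnect_bridge h; exists (findex next_bridge d0 x).
  exact: findex_max.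
by rewrite /nth_bridge iter_findex.
Qed.

Lemma nth_bridge_inj i j : i < nb_bridges -> j < nb_bridges ->
  nth_bridge i = nth_bridge j -> i = j.
Proof.
by move=> hi hj e; rewrite -(findex_iter hi) -/(nth_bridge i) e findex_iter.
Qed.

Definition side_dart x := if c (nx (nx x)) then nx (nx x) else nx x.

Lemma side_dart_boundary x : bridge x -> opp (side_dart x) = side_dart x.
Proof.
case/andP=> cx cnx; apply/eqP; rewrite -opp_mono /side_dart /mono.
by case: ifP => h; rewrite ?nxK ?h ?cx ?(negbTE cnx).
Qed.

Lemma side_dart_inj x y : bridge x -> bridge y -> side_dart x = side_dart y -> x = y.
Proof.
move=> /andP[cx cnx] /andP[cy cny]; rewrite /side_dart.
have I := triangular_inj nx3.
case: ifP => hx; case: ifP => hy; [by do 2 move/I| | |by move/I].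
  by move/I => e; rewrite e cy in cnx.
by move/I => e; rewrite e (negbTE cny) in cx.
Qed.

Lemma mono_side_dart x : mono x -> exists2 y, bridge y & side_dart y = x.
Proof.
rewrite /mono => mx; have := cM x; rewrite /mixed -(eqP mx) eqxx => h.
move: h (eqP mx); case cx: (c x) => h /esym cnx; move: h.
  rewrite /= eqb_id => h; exists (nx x); first by rewrite /bridge cnx h.
  by rewrite /side_dart nxK cx.
rewrite /= eqbF_neg negbK => h; exists (nx (nx x)); first by rewrite /bridge nxK cx h.
by rewrite /side_dart !nxK cnx.
Qed.

Definition third_colour x := c (nx (nx x)).

(** If all boundary sides had the same colour, all bridging arcs would share an end on the other
    component, and pivoting around it would never reach the boundary. *)
Lemma third_colour_both :
  (exists2 x, bridge x & third_colour x) /\ (exists2 x, bridge x & ~~ third_colour x).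
Proof.
split; apply: contrapT => H.
- have t0 x : bridge x -> c (nx (nx x)) = false.
    by move=> bx; apply/negP => h; apply: H; exists x.
  have bt x : bridge x -> bridge (nx (opp x)).
    move=> bx; have := next_bridge_bridge bx; rewrite /next_bridge bx.
    by case: ifP => // h /t0; rewrite nxK c_nx_opp; case/andP: bx => ->.
  have b n : bridge (iter n (fun y => nx (opp y)) d0) by elim: n => //= n /bt.
  by case: (nxP d0) => n /=; apply/negP/bridge_opp.
have t1 x : bridge x -> c (nx (nx x)).
  by move=> bx; apply: contrapT => h; apply: H; exists x => //; apply/negP.
pose bridge' y := ~~ c y && c (nx y).
have bt y : bridge' y -> bridge' (nx (opp y)).
  move=> /andP[cy cny]; have b : bridge (opp y) by rewrite /bridge c_opp c_nx_opp cny.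
  by rewrite /bridge' c_nx_opp cy t1.
have b n : bridge' (iter n (fun y => nx (opp y)) (opp d0)).
  elim: n => [|n /bt//]; case/andP: d0b => cd cnd.
  by rewrite /= /bridge' c_opp c_nx_opp cnd.
case: (nxP (opp d0)) => n /= /eqP e; have := b n.
by rewrite /bridge' -c_opp e andNb.
Qed.

Lemma third_colour_change :
  exists k, third_colour (nth_bridge k) != third_colour (nth_bridge k.+1).
Proof.
apply: contrapT => H; have E k : third_colour (nth_bridge k) = third_colour d0.
  elim: k => // k <-; apply/esym/eqP; apply: contrapT => h; apply: H.
  by exists k; apply/negP.
case: third_colour_both => [[x bx tx] [y by_ ty]].
have [i _ xi] := nth_bridge_surj bx; have [j _ yj] := nth_bridge_surj by_.
by move: tx ty; rewrite xi yj !E => ->.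
Qed.

Section Arcs.

Definition bridge_arc k := ar (nth_bridge k).
Definition side_arc k := ar (side_dart (nth_bridge k)).

Lemma arc_cases v : exists2 k, k < nb_bridges & v = bridge_arc k \/ v = side_arc k.
Proof.
have : v \in [set: V] by rewrite inE.
rewrite arcs_cover => /setUP[] /imsetP[x]; rewrite unfold_in => hx ->.
  have [k lk ->] := nth_bridge_surj hx; exists k => //; by left.
have [y by_ <-] := mono_side_dart hx; have [k lk ->] := nth_bridge_surj by_.
by exists k => //; right.
Qed.

Lemma bridge_arc_inj i j : i < nb_bridges -> j < nb_bridges ->
  bridge_arc i = bridge_arc j -> i = j.
Proof.
move=> hi hj /ar_eq[] e; first by apply: nth_bridge_inj.
have := nth_bridgeP j; rewrite e /bridge c_opp c_nx_opp.
by case/andP: (nth_bridgeP i) => -> /negbTE ->.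
Qed.

Lemma side_arc_inj i j : i < nb_bridges -> j < nb_bridges ->
  side_arc i = side_arc j -> i = j.
Proof.
move=> hi hj /ar_eq; rewrite side_dart_boundary ?nth_bridgeP // => h.
have {}h : side_dart (nth_bridge j) = side_dart (nth_bridge i) by case: h.
by apply: nth_bridge_inj => //; apply/esym/side_dart_inj; rewrite ?nth_bridgeP.
Qed.

(** With [bridge_corner_opp], this identifies the four sides of the quadrilateral around a bridging
    arc, from which its exchange relation is read. *)
Lemma bridge_corner k : let x := nth_bridge k.+1 in
  if third_colour x then ar (nx x) = bridge_arc k /\ ar (nx (nx x)) = side_arc k.+1
  else ar (nx x) = side_arc k.+1 /\ ar (nx (nx x)) = bridge_arc k.
Proof.
move=> x; have bx : bridge x by apply: nth_bridgeP.
have px : prev x = nth_bridge k by rewrite /x [nth_bridge _]/= prevK ?nth_bridgeP.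
rewrite /bridge_arc /side_arc -px -/x; move: (x).
by move=> {bx px}y; rewrite /side_dart /prev /third_colour; case: (c _); rewrite ar_opp.
Qed.

Lemma bridge_corner_opp k : let x := opp (nth_bridge k) in let z := nth_bridge k.+1 in
  if third_colour z then ar (nx x) = side_arc k.+1 /\ ar (nx (nx x)) = bridge_arc k.+1
  else ar (nx x) = bridge_arc k.+1 /\ ar (nx (nx x)) = side_arc k.+1.
Proof.
move=> x z; have bk := nth_bridgeP k.
rewrite /bridge_arc /side_arc -/z /third_colour.
have zE : z = if c (nx (nx x)) then nx (nx x) else nx x.
  by rewrite /z [nth_bridge _]/= /next_bridge bk.
have cx : c (nx x) by rewrite c_nx_opp; case/andP: bk.
have cx' : c x = false by rewrite c_opp; case/andP: bk => _ /negbTE.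
by case: (c (nx (nx x))) zE => ->; rewrite /side_dart !nxK ?cx ?cx'.
Qed.

End Arcs.

End Bridging.

(** * Gluings *)

Section Gluing.
Variable T : gluing.
Local Notation D := (dart T).
Local Notation opp := (@Defs.opp T).
Local Notation ar := (@dart_arc T).

Let same_arc (x : D) := [pred d : D | ar d == ar x].

Lemma card_same_arc x : (0 < #|same_arc x| <= 2)%N.
Proof. exact: sides_of_arc. Qed.

Lemma opp_spec (x : D) : (opp x = x /\ forall y, ar y = ar x -> y = x) \/
  [/\ ar (opp x) = ar x, opp x != x & forall y, ar y = ar x -> y = x \/ y = opp x].
Proof.
rewrite /Defs.opp; case: pickP => [y /andP[/eqP ay yx]|h] /=.
  right; split=> // z az; have [|zx] := eqVneq z x; first by left.
  right; apply/eqP; apply: contraT => zy; case/andP: (card_same_arc x) => _.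
  have u : uniq [:: x; y; z] by rewrite /= !inE !negb_or !(eq_sym x) yx zx eq_sym zy.
  rewrite leqNgt => /negP[]; rewrite -[3]/(size [:: x; y; z]) -(card_uniqP u).
  apply/subset_leq_card/fintype.subsetP => t; rewrite !inE.
  by case/or3P=> /eqP->; rewrite ?ay ?az.
left; split=> // y ay; apply/eqP; have := h y; rewrite /= ay eqxx /= => /negbFE.
by [].
Qed.

Lemma ar_oppE x : ar (opp x) = ar x.
Proof. by case: (opp_spec x) => [[-> _]|[]]. Qed.

Lemma ar_eq_opp x y : ar x = ar y -> y = x \/ y = opp x.
Proof.
move=> /esym e; case: (opp_spec x) => [[_ h]|[_ _ h]]; last exact: h.
by left; apply: h.
Qed.

Lemma opp_involutive : involutive opp.
Proof.
move=> x; case: (opp_spec x) => [[h _]|[ax xN _]]; first by rewrite !h.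
case: (opp_spec (opp x)) => [[_ h]|[_ _ h]]; have := h _ (esym ax).
  by move=> e; rewrite -e eqxx in xN.
by case=> // e; rewrite -e eqxx in xN.
Qed.

Lemma boundary_opp x : boundary_arc (ar x) = (opp x == x).
Proof.
rewrite /boundary_arc; apply/eqP/eqP => [/eqP h|h].
  case: (opp_spec x) => [[] //|[ax nx _]]; move: h.
  have : #|[set x; opp x]| <= #|same_arc x|.
    apply/subset_leq_card/fintype.subsetP => t; rewrite !inE.
    by case/orP=> /eqP->; rewrite ?ax.
  by rewrite cards2 eq_sym nx /= /same_arc => h1 /eqP h2; rewrite h2 in h1.
case: (opp_spec x) => [[_ u]|[_ /eqP]//].
rewrite -(card1 x); apply: eq_card => y; rewrite !inE.
by apply/eqP/eqP => [/u//|->].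
Qed.

Lemma dart_arc_surj v : exists x, ar x = v.
Proof.
by case/andP: (sides_of_arc v) => /card_gt0P[x /eqP xv] _; exists x.
Qed.

Lemma ordS3 (i : 'I_3) : ordS (ordS (ordS i)) = i /\ ordS i != i.
Proof. by case: i => [[|[|[]]]] //= h; split=> //; apply: val_inj. Qed.

Lemma next_side_triangular : triangular (@next_side T).
Proof.
split=> [[t i]|[t i]]; rewrite /next_side /=; have [e n] := ordS3 i.
  by rewrite e.
by rewrite xpair_eqE eqxx n.
Qed.

Lemma turn_inj : injective (@turn T).
Proof.
exact: inj_comp (triangular_inj next_side_triangular) (can_inj opp_involutive).
Qed.

Lemma no_puncture_unpunctured : no_puncture T -> unpunctured opp (@next_side T).
Proof.
move=> /forallP np x; have /existsP[d /andP[/connectP[p pP ->]]] := np x.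
rewrite -/(turn _); elim: p x pP => [|y p IH] x /=; first by rewrite boundary_opp; exists 0.
move=> /andP[xy /IH h] /h [n hn].
case/orP: xy => /andP[b /eqP e]; first by exists n.+1; rewrite iterSr -/(turn x) e.
(* The edge is traversed backwards: [y] is not on the boundary, so its orbit begins with a step to
   [x]. *)
case: n hn => [|n]; first by move=> /=; rewrite -boundary_opp (negbTE b).
by rewrite iterSr -/(turn y) e => hn; exists n.
Qed.

Lemma connected_transitive : connected_surface T ->
  transitive_on_darts opp (@next_side T).
Proof.
move=> /eqP c1 S [[t0 i0] S0] Sn So.
have adj_sym : connect_sym (@adjacent T).
  apply: sym_connect_sym => t t'; apply/existsP/existsP => -[i /existsP[j /eqP e]];
  by exists j; apply/existsP; exists i; rewrite e.
have St t i j : S (t, i) -> S (t, j).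
  move=> h; have h1 := Sn _ h; have h2 := Sn _ h1; rewrite /next_side /= in h1 h2.
  have : [|| j == i, j == ordS i | j == ordS (ordS i)].
    by case: i j {h h1 h2} => [[|[|[]]]] //= hi [[|[|[]]]].
  by case/or3P=> /eqP->.
have all1 t t' : fingraph.root (@adjacent T) t = fingraph.root (@adjacent T) t'.
  have := eq_leq c1; rewrite /n_comp_mem => /card_le1_eqP; apply;
    by rewrite !inE roots_root.
move=> [t i]; have /connectP[p] : connect (@adjacent T) t0 t.
  by rewrite -root_connect //; apply/eqP.
elim: p t0 i0 S0 => [|t1 p IH] t0 i0 S0 /=; first by move=> _ ->; apply: St S0.
move=> /andP[/existsP[k /existsP[l /eqP e]] pP] lE; apply: (IH t1 l) => //.
have Sk := St _ _ k S0.
by case: (@ar_eq_opp (t0, k) (t1, l) e) => ->; last exact: So.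
Qed.

(** Colour by membership in one orbit of [turn]. Without a mixed triangle this orbit would be stable
    under [next_side] and [opp], and would contain the root of the other orbit. *)
Lemma colouring_of_boundaries : connected_surface T ->
  nb_boundary_components T = 2 ->
  exists c, colouring opp (@next_side T) c /\ exists x, mixed (@next_side T) c x.
Proof.
move=> /connected_transitive tr b2.
have sym := fconnect_sym turn_inj.
have /card_gt1P[r1 [r2 [r1R r2R r12]]] : 1 < nb_boundary_components T by rewrite b2.
have cP : colouring opp (@next_side T) (fconnect (@turn T) r1).
  by move=> x; apply/esym/(same_connect_r sym)/fconnect1.
exists (fconnect (@turn T) r1); split=> //; apply: contrapT => noM.
have mono x : fconnect (@turn T) r1 (next_side x) = fconnect (@turn T) r1 x.
  have : ~~ mixed (@next_side T) (fconnect (@turn T) r1) x.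
    by apply/negP => h; apply: noM; exists x.
  by rewrite negbK => /andP[/eqP].
have : fconnect (@turn T) r1 r2.
  apply: (tr (fconnect (@turn T) r1)) => [|x|x].
  - by exists r1; apply: connect0.
  - by rewrite mono.
  - by rewrite -mono -{1}[x]opp_involutive cP.
rewrite -(root_connect sym); move: r1R r2R; rewrite !inE => /andP[/eqP-> _] /andP[/eqP-> _].
by rewrite (negbTE r12).
Qed.

Lemma nb_points_le : no_puncture T -> nb_points T <= #|[pred x | opp x == x]|.
Proof.
move=> /forallP np.
have sym : connect_sym (@same_point T).
  by apply: sym_connect_sym => x y; rewrite /same_point orbC.
apply: leq_trans (leq_imset_card (fingraph.root (@same_point T)) _).
apply/subset_leq_card/fintype.subsetP => r; rewrite inE => /andP[rR _].
have /existsP[d /andP[rd db]] := np r.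
apply/imsetP; exists d; first by rewrite inE -boundary_opp.
by move: rd; rewrite -(root_connect sym) (eqP rR) => /eqP.
Qed.

(** An interior arc contributes two darts; a boundary arc contributes one dart, counted twice as a
    fixed point of [opp]. *)
Lemma card_darts : #|D| + #|[pred x | opp x == x]| = 2 * #|arc T|.
Proof.
transitivity (\sum_(x : D) (1 + (opp x == x))).
  rewrite big_split /= sum1_card; congr (_ + _).
  by rewrite -sum1_card big_mkcond; apply: eq_bigr => x _; rewrite inE; case: (_ == _).
rewrite (partition_big ar predT) //= mulnC -sum_nat_const.
apply: eq_bigr => v _; have [x xv] := dart_arc_surj v.
rewrite (eq_bigl (mem [:: x; opp x])); last first.
  move=> y /=; rewrite !inE -xv; apply/eqP/orP.
    by move=> /esym/ar_eq_opp[]->; [left|right].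
  by case=> /eqP->; rewrite ?ar_oppE.
have [e|n] := eqVneq (opp x) x.
  rewrite (eq_bigl (pred1 x)) ?big_pred1_eq ?e ?eqxx // => y.
  by rewrite !inE orbb.
rewrite -big_uniq /=; last by rewrite inE eq_sym n.
by rewrite !big_cons big_nil opp_involutive (eq_sym x) (negbTE n).
Qed.

Lemma triangulates_card m : triangulates T 0 2 m ->
  2 * #|D| <= 3 * #|arc T| /\ m + #|triangle T| = #|arc T|.
Proof.
move=> [_ /nb_points_le np <- _]; have := card_darts; rewrite card_prod card_ord.
by move=> h1 h2; split; lia.
Qed.

Lemma triangulation_arrows : arrows (i := triangulation_quiver T) =
  dart_arrows (Q := triangulation_quiver T) ar (@next_side T).
Proof. by []. Qed.

End Gluing.

(** * Counting *)

Section Count.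
Variable F : finFieldType.
Local Notation S := (F * F)%type.

(* Successive values of (e_k, h_k), where h_k is the value of the boundary arc
   if e_k <> 0, and of the mutated bridging arc otherwise. *)
Definition compatible (s s' : S) : bool :=
  ((s'.1 != 0%R) ==> (s'.2 != 0%R)) && ((s.1 != 0%R) || (s'.1 != 0%R)).

Lemma sum_tuple_cons (I : finType) n (f : seq I -> nat) :
  \sum_(t : n.+1.-tuple I) f t = \sum_x \sum_(t : n.-tuple I) f (x :: t).
Proof.
rewrite pair_bigA /=.
rewrite (reindex (fun p : I * n.-tuple I => [tuple of p.1 :: p.2])) //=.
exists (fun t => (thead t, [tuple of behead t])) => [[x t] _|t _] /=.
  by rewrite theadE; congr (_, _); apply: val_inj.
by rewrite [RHS](tuple_eta t); apply: val_inj.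
Qed.

Let q := #|F|.

(** Transfer matrix on the classes of states, [true] meaning a nonzero first coordinate: [q] states
    have a zero one, allowed only after a nonzero one, and [(q - 1) ^ 2] admissible states have a
    nonzero one. *)
Fixpoint class_paths (n : nat) (a b : bool) : nat :=
  if n is n'.+1 then
    a * (q * class_paths n' false b) + (q - 1) ^ 2 * class_paths n' true b
  else a || b.

Lemma sum_compatible (s : S) (f : bool -> nat) :
  \sum_(s' : S) compatible s s' * f (s'.1 != 0%R)
  = (s.1 != 0%R) * (q * f false) + (q - 1) ^ 2 * f true.
Proof.
have c1 : \sum_(x : F | x != 0%R) 1 = q - 1.
  by rewrite sum1_card cardC1 subn1.
have E0 : \sum_y compatible s (0%R, y) * f false = (s.1 != 0%R) * (q * f false).
  rewrite (eq_bigr (fun=> (s.1 != 0%R) * f false)); last first.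
    by move=> y _; rewrite /compatible /= eqxx orbF.
  by rewrite sum_nat_const mulnCA.
have E1 x : x != 0%R -> \sum_y compatible s (x, y) * f true = (q - 1) * f true.
  move=> x0; rewrite -big_distrl /= (bigID (fun y => y == 0%R)) /=.
  rewrite big1 => [|y /eqP->]; last by rewrite /compatible /= x0 eqxx.
  rewrite add0n (eq_bigr (fun=> 1)) ?c1 // => y y0.
  by rewrite /compatible /= x0 y0 orbT.
rewrite -(pair_bigA _ (fun x y => compatible s (x, y) * f (x != 0%R))) /=.
rewrite (bigD1 0%R) //= eqxx E0; congr addn.
rewrite (eq_bigr (fun=> 1 * ((q - 1) * f true))) => [|x x0].
  by rewrite -big_distrl /= c1 mulnA.
by rewrite x0 E1 // mul1n.
Qed.

Lemma count_paths n (s z : S) :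
  \sum_(t : n.-tuple S) path compatible s (rcons t z)
  = ((z.1 != 0%R) ==> (z.2 != 0%R)) * class_paths n (s.1 != 0%R) (z.1 != 0%R).
Proof.
elim: n s => [|n IH] s.
  rewrite (big_pred1 [tuple]) => [|t]; last exact/esym/eqP/tuple0.
  by rewrite /= andbT /compatible mulnb.
rewrite (sum_tuple_cons _ (fun t => nat_of_bool (path compatible s (rcons t z)))) /=.
transitivity (\sum_(s' : S) compatible s s' *
   (((z.1 != 0%R) ==> (z.2 != 0%R)) * class_paths n (s'.1 != 0%R) (z.1 != 0%R))).
  apply: eq_bigr => s' _; rewrite -IH big_distrr /=; apply: eq_bigr => t _.
  by rewrite mulnb.
pose f b := ((z.1 != 0%R) ==> (z.2 != 0%R)) * class_paths n b (z.1 != 0%R).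
rewrite [LHS](sum_compatible s f) /f.
move: (nat_of_bool (_ ==> _)) => w; rewrite mulnDr.
by rewrite !(mulnCA w).
Qed.

Lemma class_paths_trace n : (0 < q)%N ->
  ((q * class_paths n false false + (q - 1) ^ 2 * class_paths n true true)%:Z
   = (q%:Z - 1) ^+ n.+1 * (q%:Z ^+ n.+1 + (-1) ^+ n.+1))%R.
Proof.
move=> q0; have q1 : ((q - 1)%N%:Z = q%:Z - 1)%R by rewrite -subzn.
have [w wq] : exists w, w = ((q - 1) ^ 2)%N by eexists.
(* Cayley-Hamilton for the transfer matrix, of trace [w] and determinant [- q * w]. *)
have rec m a b : (class_paths m.+2 a b =
    w * class_paths m.+1 a b + q * w * class_paths m a b)%N.
  by case: a; case: m => [|m]; case: b => /=; rewrite -wq; ring.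
pose t m := (q * class_paths m false false + w * class_paths m true true)%N.
rewrite -wq -/(t n).
suff [] : ((t n)%:Z = (q%:Z - 1) ^+ n.+1 * (q%:Z ^+ n.+1 + (-1) ^+ n.+1) /\
  (t n.+1)%:Z = (q%:Z - 1) ^+ n.+2 * (q%:Z ^+ n.+2 + (-1) ^+ n.+2))%R by [].
have wE : (w%:Z = (q%:Z - 1) ^+ 2)%R by rewrite -q1 wq expnS expn1 PoszM expr2.
elim: n => [|n [IH1 IH2]].
  have -> : t 0 = w by rewrite /t /=; ring.
  have -> : t 1 = (q * w + w * q + w * w)%N by rewrite /t /= -wq; ring.
  by rewrite !PoszD !PoszM wE; split; ring.
split=> //; have -> : (t n.+2 = w * t n.+1 + q * w * t n)%N.
  by rewrite /t !rec; ring.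
by rewrite PoszD !PoszM IH1 IH2 wE !exprS; ring.
Qed.

Lemma count_cycles n :
  (#|[set t : n.+1.-tuple S | cycle compatible t]|%:Z
   = (q%:Z - 1) ^+ n.+1 * (q%:Z ^+ n.+1 + (-1) ^+ n.+1))%R.
Proof.
have q0 : (0 < q)%N by apply/card_gt0P; exists 0%R.
rewrite -class_paths_trace //; congr Posz.
transitivity (\sum_(t : n.+1.-tuple S) cycle compatible t).
  rewrite -sum1_card big_mkcond; apply: eq_bigr => t _.
  by rewrite inE; case: (cycle _ _).
rewrite (sum_tuple_cons _ (fun t => nat_of_bool (cycle compatible t))) /=.
under eq_bigr do rewrite count_paths.
pose f b := class_paths n b b.
(* Any state satisfying its own condition may follow [(1, 1)], so this fictitious predecessor gives
   the sum over the first state of the cycle. *)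
have := sum_compatible (1%R, 1%R) f; rewrite /= oner_neq0 mul1n => <-.
by apply: eq_bigr => s _; rewrite /compatible /= oner_neq0 andbT.
Qed.

End Count.

(** * Generators of the cluster algebra *)

Section Subrings.
Variables (D : finType) (Q : ice_quiver) (ar : D -> vertex Q) (opp : D -> D).
Hypothesis oppK : involutive opp.
Hypothesis ar_opp : forall x, ar (opp x) = ar x.
Hypothesis ar_eq : forall x y, ar x = ar y -> y = x \/ y = opp x.
Hypothesis frozen_ar : forall x, frozen (ar x) = (opp x == x).
Hypothesis ar_surj : forall v, exists x, ar x = v.
Local Notation K := (ambient_field Q).
Local Open Scope ring_scope.

Lemma dart_arrows_cancelled nx : cancelled (dart_arrows ar nx).
Proof.
move=> i j; split; last by rewrite /dart_arrows => -> ->.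
rewrite /dart_arrows [frozen j && _]andbC; case: ifP => _; first by left.
by case: (leqP (steps ar nx i j) (steps ar nx j i)) => h; [left|right]; lia.
Qed.

Lemma mutates_arrows (ks : seq (vertex Q)) s : seed_arrows (mutates ks s) =
  foldl (fun a k => mutate_arrows k a) (seed_arrows s) ks.
Proof. by elim: ks s => //= k ks IH s; rewrite IH. Qed.

Lemma mutates_frozen ks (s : seed Q) v : all (fun k => ~~ frozen k) ks -> frozen v ->
  seed_var (mutates ks s) v = seed_var s v.
Proof.
elim: ks s => //= k ks IH s /andP[kN ksN] fv; rewrite IH //= /mutate_var ifN //.
by apply: contraNneq kN => <-.
Qed.

Variable W : K -> Prop.
Hypothesis W1 : W 1.
Hypothesis WB : forall x y, W x -> W y -> W (x - y).
Hypothesis WM : forall x y, W x -> W y -> W (x * y).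

Definition framed_seed (s : seed Q) := exists nx,
  [/\ triangular nx, unpunctured opp nx, seed_arrows s = dart_arrows ar nx &
      framed ar opp W nx (seed_var s)].

Lemma mutate_framed_seed k s : ~~ frozen k -> reachable s -> framed_seed s ->
  framed_seed (mutate k s).
Proof.
move=> kN sR [nx [nx3 nxP sE sF]]; have [d dk] := ar_surj k.
have dN : opp d != d by rewrite -frozen_ar dk.
exists (flip opp nx d); split.
- exact: flip_triangular.
- exact: flip_unpunctured.
- by rewrite /= sE flip_arrows // dk.
apply: (flip_framed oppK ar_opp ar_eq W1 WB WM nx3 nxP dN _ _ _ sF).
- exact: positive_neq0 (positive_reachable sR _).
- by move=> v vd /=; rewrite /mutate_var -dk (negbTE vd).
by rewrite /= -dk; apply: (@flip_var _ _ ar opp oppK ar_opp ar_eq frozen_ar nx d).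
Qed.

Lemma reachable_framed s0 s : reachable s0 -> framed_seed s0 ->
  (exists2 ks, all (fun k => ~~ frozen k) ks & mutates ks s0 = s) -> framed_seed s.
Proof.
move=> s0R s0F [ks]; elim: ks s0 s0R s0F => [|k ks IH] s0 s0R s0F /=; first by move=> _ <-.
move=> /andP[kN ksN]; apply: IH => //; first exact: reachable_mutate.
exact: mutate_framed_seed.
Qed.

Variables (nx0 nx1 : D -> D) (ks : seq (vertex Q)).
Hypothesis arrows0 : arrows (i := Q) = dart_arrows ar nx0.
Hypothesis ksN : all (fun k => ~~ frozen k) ks.
Hypothesis arrows1 : dart_arrows ar nx1 =
  foldl (fun a k => mutate_arrows k a) (dart_arrows ar nx0) ks.
Hypotheses (nx3 : triangular nx1) (nxP : unpunctured opp nx1).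
Hypothesis bd1 : forall x,
  [|| opp x == x, opp (nx1 x) == nx1 x | opp (nx1 (nx1 x)) == nx1 (nx1 x)].
Hypothesis bd2 : forall x, opp x == x -> opp (nx1 x) != nx1 x.

Definition seed1 := mutates ks (initial_seed Q).

Lemma seed1_reachable : reachable seed1.
Proof. by apply: mutates_reachable => //; apply: reachable_initial. Qed.

Lemma seed1_arrows : seed_arrows seed1 = dart_arrows ar nx1.
Proof. by rewrite mutates_arrows arrows1 /= arrows0. Qed.

Lemma seed1_back : mutates (rev ks) seed1 = initial_seed Q.
Proof.
have [] // := mutates_rev ksN _ (@positive_initial Q).
by rewrite /= arrows0; apply: dart_arrows_cancelled.
Qed.

(** A framing with entries in [W] exists at [seed1]; mutating back carries it to the initial seed
    and from there to all reachable seeds, so every cluster variable is a determinant of vectors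
    over [W]. *)
Lemma in_cluster_algebra_sub :
  (forall v, W (seed_var seed1 v)) ->
  (forall v, frozen v -> W (seed_var seed1 v)^-1) ->
  (forall v, ~~ frozen v -> W (mutate_var v seed1 v)) ->
  forall z, in_cluster_algebra z -> W z.
Proof.
move=> hW hV hX.
have F1 : framed_seed seed1.
  exists nx1; split=> //; first exact: seed1_arrows.
  apply: framed_one_boundary_side => //.
  - by move=> v; apply: positive_neq0 (positive_reachable seed1_reachable v).
  - by move=> x xb; apply: hV; rewrite frozen_ar.
  move=> x xN; have := hX (ar x); rewrite frozen_ar => /(_ xN).
  rewrite (@flip_var _ _ ar opp oppK ar_opp ar_eq frozen_ar nx1 x) //.
  exact: seed1_arrows.
have F0 : framed_seed (initial_seed Q).
  apply: (reachable_framed seed1_reachable F1); exists (rev ks); last exact: seed1_back.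
  by rewrite all_rev.
have FR s : reachable s -> framed_seed s.
  by elim=> // k s0 kN s0R; apply: mutate_framed_seed.
move=> z; elim=> //.
- by move=> x y _ wx _ wy; apply: WB.
- by move=> x y _ wx _ wy; apply: WM.
- move=> _ [s [v [/FR[nx [_ _ _ sF]] ->]]]; have [x <-] := ar_surj v.
  exact: (framed_in WB WM x sF).
by move=> v fv; rewrite -(mutates_frozen _ ksN fv); apply: hV.
Qed.

End Subrings.

(** * Exchange relations along a cycle *)

Section Periodic.
Variables (A : Type) (n : nat) (g : nat -> A).
Hypothesis gP : forall k, g (k + n.+1) = g k.

Lemma periodic_modn k : g (k %% n.+1) = g k.
Proof.
rewrite [in RHS](divn_eq k n.+1) addnC; elim: (k %/ n.+1) => [|j IH]; first by rewrite addn0.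
by rewrite mulSn addnCA addnC gP.
Qed.

Lemma periodic_ext (h : nat -> A) : (forall k, h (k + n.+1) = h k) ->
  (forall i, i < n.+1 -> g i = h i) -> forall k, g k = h k.
Proof.
move=> hP gh k; rewrite -periodic_modn gh ?ltn_mod //.
rewrite [in RHS](divn_eq k n.+1) addnC; elim: (k %/ n.+1) => [|j IH]; first by rewrite addn0.
by rewrite mulSn addnCA addnC hP.
Qed.

Lemma periodic_cycle (r : rel A) :
  cycle r (mkseq g n.+1) <-> forall k, r (g k) (g k.+1).
Proof.
have E : rcons (map g (iota 1 n)) (g 0) = map g (iota 1 n.+1).
  by rewrite -[in RHS](addn1 n) iotaD map_cat /= cats1 -(gP 0) add0n add1n.
have nthE i : i <= n.+1 -> nth (g 0) (g 0 :: map g (iota 1 n.+1)) i = g i.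
  by move=> hi; rewrite -map_cons -[0 :: _]/(iota 0 n.+2) (nth_map 0) ?size_iota // nth_iota.
have nthE' i : i < n.+1 -> nth (g 0) (map g (iota 1 n.+1)) i = g i.+1.
  by move=> hi; rewrite -(nthE i.+1).
rewrite /mkseq -[cycle _ _]/(path r (g 0) (rcons (map g (iota 1 n)) (g 0))) E.
split=> [/(pathP (g 0)) h k|h]; last first.
  apply/(pathP (g 0)) => i; rewrite size_map size_iota => hi.
  by rewrite nthE ?nthE' // ltnW.
have hk : k %% n.+1 < n.+1 by rewrite ltn_mod.
have -> : g k.+1 = g (k %% n.+1).+1.
  rewrite -[LHS]periodic_modn -[RHS]periodic_modn; congr g.
  by rewrite -addn1 -[in RHS]addn1 modnDml.
have := h (k %% n.+1); rewrite size_map size_iota => /(_ hk).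
by rewrite (nthE _ (ltnW hk)) (nthE' _ hk) periodic_modn.
Qed.

End Periodic.

Section Exchange.
Variables (n : nat) (t : nat -> bool) (L : fieldType).
Local Open Scope ring_scope.

(* Index k + n stands for k - 1. *)
Definition exchange_coef (x y : nat -> L) k := if t k == t k.+1 then x k.+1 else y k.+1.
Definition exchange_rest (x y : nat -> L) k :=
  if t k == t k.+1 then y k.+1 * x (k + n)%N else x (k + n)%N * x k.+1.
Definition exchange (x y : nat -> L) k := y k * exchange_coef x y k + exchange_rest x y k.

End Exchange.

Section Solutions.
Variables (n : nat) (t : nat -> bool) (L : fieldType).
Local Open Scope ring_scope.
Hypothesis tP : forall k, t (k + n.+1)%N = t k.
Hypothesis tC : exists k, t k != t k.+1.

(** By the exchange relation, two consecutive zeros force a third one and the equality of the next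
    two values of [t]; going round the cycle, [t] would be constant. *)
Lemma no_adjacent_zeros (x x' y : nat -> L) :
  (forall k, x (k + n.+1)%N = x k) -> (forall k, y k != 0) ->
  (forall k, x' k * x k = exchange n t x y k) ->
  forall k, (x k != 0) || (x k.+1 != 0).
Proof.
move=> xP y0 ex; suff H k : x k = 0 -> x k.+1 = 0 -> x k.+2 = 0 /\ t k.+1 = t k.+2.
  move=> k; apply/contraT; rewrite negb_or !negbK => /andP[/eqP xk /eqP xk1].
  have Hj j : x (k + j)%N = 0 /\ x (k + j).+1 = 0.
    elim: j => [|j [h1 h2]]; first by rewrite addn0.
    by have [h3 _] := H _ h1 h2; rewrite addnS.
  have Ht j : t (k.+1 + j)%N = t (k.+1 + j).+1.
    by have [h1 h2] := Hj j; have [_] := H _ h1 h2; rewrite addSn.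
  have tk j : t (k.+1 + j)%N = t k.+1.
    by elim: j => [|j <-]; [rewrite addn0 | rewrite addnS -Ht].
  have tall i : t i = t k.+1.
    have -> : t i = t (i + k.+1 * n.+1)%N.
      by elim: k.+1 => [|j IH]; rewrite ?mul0n ?addn0 // mulSn addnCA addnC tP.
    by rewrite -(tk (i + k.+1 * n)%N); congr t; lia.
  by case: tC => i; rewrite !tall eqxx.
move=> xk xk1; have := ex k.+1; rewrite xk1 mulr0 /exchange /exchange_coef /exchange_rest.
have -> : (k.+1 + n = k + n.+1)%N by rewrite addSnnS.
rewrite xP xk; case: eqP => [-> /esym /eqP|_].
  by rewrite mulr0 addr0 mulf_eq0 (negbTE (y0 _)) /= => /eqP.
by rewrite mul0r addr0 => /esym /eqP; rewrite mulf_eq0 !(negbTE (y0 _)).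
Qed.

End Solutions.

(** * Points *)

Section Chart.
Variables (n : nat) (t Z : nat -> bool) (L : fieldType).
Local Open Scope ring_scope.

(* Where the bridging variable x k vanishes, its mutation h k replaces the
   boundary variable as a coordinate; the latter is recovered from the exchange
   relation x k * h k = exchange x y k, which is linear in it. *)
Definition chart (x h : nat -> L) k :=
  if Z k then (x k * h k - exchange_rest n t x h k) / exchange_coef t x h k else h k.

Lemma chart_coef_rest (x h : nat -> L) k : ~~ Z k.+1 ->
  exchange_coef t x (chart x h) k = exchange_coef t x h k /\
  exchange_rest n t x (chart x h) k = exchange_rest n t x h k.
Proof. by move=> /negbTE zk; rewrite /exchange_coef /exchange_rest /chart zk. Qed.

Lemma chart_exchange (x h : nat -> L) k : Z k -> ~~ Z k.+1 -> exchange_coef t x h k != 0 ->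
  exchange n t x (chart x h) k = x k * h k.
Proof.
move=> zk zk1 c0; rewrite /exchange; have [-> ->] := chart_coef_rest x h zk1.
by rewrite /chart zk divfK // subrK.
Qed.

End Chart.

Section PartialMorphism.
Variable Q : ice_quiver.
Local Notation K := (ambient_field Q).
Local Open Scope ring_scope.
Variables (E : fieldType) (ev : K -> E -> Prop).
Hypothesis ev1 : ev 1 1.
Hypothesis evB : forall w w' e e', ev w e -> ev w' e' -> ev (w - w') (e - e').
Hypothesis evM : forall w w' e e', ev w e -> ev w' e' -> ev (w * w') (e * e').
Variables (n : nat) (t : nat -> bool).
Variables (x y : nat -> K) (x' y' : nat -> E).
Hypothesis evx : forall k, ev (x k) (x' k).
Hypothesis evy : forall k, ev (y k) (y' k).

Lemma ev_coef k : ev (exchange_coef t x y k) (exchange_coef t x' y' k).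
Proof. by rewrite /exchange_coef; case: ifP. Qed.

Lemma ev_rest k : ev (exchange_rest n t x y k) (exchange_rest n t x' y' k).
Proof. by rewrite /exchange_rest; case: ifP => _; apply: evM. Qed.

Lemma ev_exchange k : ev (exchange n t x y k) (exchange n t x' y' k).
Proof.
apply: (evD ev1 evB); last exact: ev_rest.
by apply: evM => //; apply: ev_coef.
Qed.

Hypothesis evV : forall w e, e != 0 -> ev w e -> ev w^-1 e^-1.

Lemma ev_chart (Z : nat -> bool) k : (Z k -> exchange_coef t x' y' k != 0) ->
  ev (chart n t Z x y k) (chart n t Z x' y' k).
Proof.
rewrite /chart; case: (Z k) => // c0; apply: evM.
  by apply: evB; [apply: evM | apply: ev_rest].
by apply: evV; [apply: c0 | apply: ev_coef].
Qed.

End PartialMorphism.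

Section Points.
Variables (Q : ice_quiver) (F : finFieldType) (ks : seq (vertex Q)).
Local Notation K := (ambient_field Q).
Local Notation V := (vertex Q).
Local Notation s0 := (initial_seed Q).
Let s1 := mutates ks s0.
Local Open Scope ring_scope.
Hypothesis ksN : all (fun k => ~~ frozen k) ks.
Hypothesis arrows_cancelled : cancelled (seed_arrows s0).
Hypothesis cancelled1 : cancelled (seed_arrows s1).
Hypothesis algebra_sub : forall W : K -> Prop, W 1 ->
  (forall x y, W x -> W y -> W (x - y)) ->
  (forall x y, W x -> W y -> W (x * y)) ->
  (forall v, W (seed_var s1 v)) ->
  (forall v, frozen v -> W (seed_var s1 v)^-1) ->
  (forall v, ~~ frozen v -> W (mutate_var v s1 v)) ->
  forall z, in_cluster_algebra z -> W z.
Variables (n : nat) (e b : nat -> V) (t : nat -> bool).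
Hypothesis eP : forall k, e (k + n.+1)%N = e k.
Hypothesis bP : forall k, b (k + n.+1)%N = b k.
Hypothesis tP : forall k, t (k + n.+1)%N = t k.
Hypothesis e_mutable : forall k, ~~ frozen (e k).
Hypothesis b_frozen : forall k, frozen (b k).
Hypothesis arcs : forall v, exists2 k, (k < n.+1)%N & v = e k \/ v = b k.
Hypothesis e_inj : forall i j, (i < n.+1)%N -> (j < n.+1)%N -> e i = e j -> i = j.
Hypothesis b_inj : forall i j, (i < n.+1)%N -> (j < n.+1)%N -> b i = b j -> i = j.
Hypothesis mutate_e : forall (s : seed Q) k, seed_arrows s = seed_arrows s1 ->
  mutate_var (e k) s (e k) =
  exchange n t (seed_var s \o e) (seed_var s \o b) k / seed_var s (e k).
Hypothesis t_change : exists k, t k != t k.+1.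

Let A := @in_cluster_algebra Q.
Let X k := seed_var s1 (e k).
Let Y k := seed_var s1 (b k).
Let X' k := mutate_var (e k) s1 (e k).

Let s1R : reachable s1.
Proof. by apply: mutates_reachable => //; apply: reachable_initial. Qed.

Let s1_neq0 v : seed_var s1 v != 0.
Proof. exact: positive_neq0 (positive_reachable s1R v). Qed.

Let A_s1 v : A (seed_var s1 v).
Proof. by apply: in_cluster_algebra_var; exists s1, v. Qed.

Let A_X' v : ~~ frozen v -> A (mutate_var v s1 v).
Proof.
move=> vN; apply: in_cluster_algebra_var; exists (mutate v s1), v; split=> //.
exact: reachable_mutate.
Qed.

Let A_inv v : frozen v -> A (seed_var s1 v)^-1.
Proof. by move=> fv; rewrite mutates_frozen //; apply: in_cluster_algebra_inv. Qed.

Let X'X k : X' k * X k = exchange n t X Y k.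
Proof. by rewrite /X' mutate_e // divfK ?s1_neq0. Qed.

(** Extension by zero outside the cluster algebra, to evaluate elements of the ambient field without
    carrying membership proofs. *)
Definition extension (f : cluster_algebra Q -> F) (w : K) : F :=
  if insub w is Some a then f a else 0.

Lemma extension_val f (a : cluster_algebra Q) : extension f (val a) = f a.
Proof. by rewrite /extension valK. Qed.

Lemma A_val w : A w -> exists a : cluster_algebra Q, w = val a.
Proof. by move=> /asboolP h; exists (ClusterAlgebra h). Qed.

Lemma val_A (a : cluster_algebra Q) : A (val a).
Proof. by case: a => w /= /asboolP. Qed.

(** * From points to coordinates *)

Section Hom.
Variable f : cluster_algebra Q -> F.
Hypothesis fP : cluster_variety_points f.

Let ev w r := A w /\ extension f w = r.

Lemma hom1 : ev 1 1.
Proof.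
split; first exact: in_cluster_algebra1.
have -> : 1 = val (1 : cluster_algebra Q) by [].
by rewrite extension_val fP.2.1.
Qed.

Lemma homB w w' r r' : ev w r -> ev w' r' -> ev (w - w') (r - r').
Proof.
move=> [/[dup] Aw /A_val[a wa] <-] [/[dup] Aw' /A_val[a' wa'] <-].
split; first exact: in_cluster_algebraB.
have -> : w - w' = val (a - a') by rewrite wa wa'.
by rewrite wa wa' !extension_val fP.1.
Qed.

Lemma homM w w' r r' : ev w r -> ev w' r' -> ev (w * w') (r * r').
Proof.
move=> [/[dup] Aw /A_val[a wa] <-] [/[dup] Aw' /A_val[a' wa'] <-].
split; first exact: in_cluster_algebraM.
have -> : w * w' = val (a * a') by rewrite wa wa'.
by rewrite wa wa' !extension_val fP.2.2.
Qed.

Lemma hom_solution k :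
  extension f (X' k) * extension f (X k) =
  exchange n t (extension f \o X) (extension f \o Y) k.
Proof.
have evE w : A w -> ev w (extension f w) by [].
have := homM (evE _ (A_X' (e_mutable k))) (evE _ (A_s1 (e k))).
rewrite -/(X' k) -/(X k) X'X => -[_ <-].
have [] // := @ev_exchange _ _ ev hom1 homB homM n t X Y
  (extension f \o X) (extension f \o Y) _ _ k.
  by move=> j; apply: evE; apply: A_s1.
by move=> j; apply: evE; apply: A_s1.
Qed.

Lemma hom_frozen k : extension f (Y k) != 0.
Proof.
have evE w : A w -> ev w (extension f w) by [].
have := homM (evE _ (A_s1 (b k))) (evE _ (A_inv (b_frozen k))).
rewrite divff // => -[_]; rewrite hom1.2 => /esym h; apply/eqP => h0.
by move: h; rewrite /Y in h0; rewrite h0 mul0r => /eqP; rewrite eq_sym oner_eq0.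
Qed.

Definition coordinates k : F * F :=
  (extension f (X k),
   if extension f (X k) == 0 then extension f (X' k) else extension f (Y k)).

Lemma coordinates_periodic k : coordinates (k + n.+1) = coordinates k.
Proof. by rewrite /coordinates /X /X' /Y eP bP. Qed.

Lemma hom_zeros k : (extension f (X k) != 0) || (extension f (X k.+1) != 0).
Proof.
apply: (no_adjacent_zeros tP t_change _ hom_frozen hom_solution) => j.
by rewrite /= /X eP.
Qed.

Lemma coordinates_compatible k : compatible (coordinates k) (coordinates k.+1).
Proof.
rewrite /compatible /= hom_zeros andbT; apply/implyP => /negbTE ->.
exact: hom_frozen.
Qed.

Definition point_tuple : n.+1.-tuple (F * F) := [tuple of mkseq coordinates n.+1].

End Hom.

Lemma point_tuple_cycle (f : cluster_algebra Q -> F) : cluster_variety_points f ->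
  cycle (@compatible F) (point_tuple f).
Proof.
move=> fP; apply/(periodic_cycle (coordinates_periodic f)).
exact: coordinates_compatible.
Qed.

Lemma point_tuple_inj (f f' : cluster_algebra Q -> F) :
  cluster_variety_points f -> cluster_variety_points f' ->
  point_tuple f = point_tuple f' -> f = f'.
Proof.
move=> fP f'P /(congr1 val) /= ff'.
have c k : coordinates f k = coordinates f' k.
  apply: (periodic_ext (coordinates_periodic f) (coordinates_periodic f')) => i hi.
  by rewrite -(nth_mkseq (0, 0) _ hi) ff' nth_mkseq.
have cX k : extension f (X k) = extension f' (X k) by case: (c k).
have cY' k : extension f (X k) != 0 -> extension f (Y k) = extension f' (Y k).
  by case: (c k) => <-; case: ifP.
have cX'' k : extension f (X k) == 0 -> extension f (X' k) = extension f' (X' k).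
  by case: (c k) => <-; case: ifP.
(* Where [X k] vanishes, the exchange relation is linear in [Y k] with coefficient [X k.+1] or
   [Y k.+1], both nonzero. *)
have cY k : extension f (Y k) = extension f' (Y k).
  have [xk|/cY'//] := eqVneq (extension f (X k)) 0.
  have xk1 : extension f (X k.+1) != 0 by have := hom_zeros fP k; rewrite xk eqxx.
  have := hom_solution f'P k; have := hom_solution fP k.
  rewrite -cX xk !mulr0 /exchange => /esym h /esym h'.
  have E g : cluster_variety_points g -> extension g (X k.+1) != 0 ->
      exchange_coef t (extension g \o X) (extension g \o Y) k != 0.
    by move=> gP g1; rewrite /exchange_coef /=; case: ifP => // _; apply: hom_frozen.
  have cE : exchange_coef t (extension f \o X) (extension f \o Y) k =
      exchange_coef t (extension f' \o X) (extension f' \o Y) k.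
    by rewrite /exchange_coef /= cX cY' // -cX.
  have rE : exchange_rest n t (extension f \o X) (extension f \o Y) k =
      exchange_rest n t (extension f' \o X) (extension f' \o Y) k.
    by rewrite /exchange_rest /= !cX cY' // -cX.
  apply: (mulIf (E f fP xk1)); move: h'; rewrite -cE -rE -h => /addIr.
  by move=> ->.
have cX' k : extension f (X' k) = extension f' (X' k).
  have [/eqP/cX''//|xk] := eqVneq (extension f (X k)) 0.
  apply: (mulIf xk); rewrite hom_solution // cX hom_solution //.
  by rewrite /exchange /exchange_coef /exchange_rest /= !cX !cY.
apply: funext => a; rewrite -!extension_val.
(* The equalizer of the two points is a subring containing the generators. *)
pose W w := A w /\ extension f w = extension f' w.
suff [] : W (val a) by [].
have evE g w : A w -> A w /\ extension g w = extension g w by [].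
apply: algebra_sub (val_A a).
- by split; [exact: in_cluster_algebra1 | rewrite (hom1 fP).2 (hom1 f'P).2].
- move=> x y [Ax xE] [Ay yE]; split; first exact: in_cluster_algebraB.
  have [_ ->] := homB fP (evE f _ Ax) (evE f _ Ay).
  by have [_ ->] := homB f'P (evE f' _ Ax) (evE f' _ Ay); rewrite xE yE.
- move=> x y [Ax xE] [Ay yE]; split; first exact: in_cluster_algebraM.
  have [_ ->] := homM fP (evE f _ Ax) (evE f _ Ay).
  by have [_ ->] := homM f'P (evE f' _ Ax) (evE f' _ Ay); rewrite xE yE.
- move=> v; split=> //; have [k _ [] ->] := arcs v; [exact: cX | exact: cY].
- move=> v fv; split; first exact: A_inv.
  have inv g : cluster_variety_points g ->
      extension g (seed_var s1 v)^-1 = (extension g (seed_var s1 v))^-1.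
    move=> gP; have [_] := homM gP (evE g _ (A_s1 v)) (evE g _ (A_inv fv)).
    rewrite divff // (hom1 gP).2 => h; apply/esym; apply: mulr1_eq.
    by rewrite h.
  rewrite !inv //; congr (_^-1).
  by have [k _ [] ->] := arcs v; [exact: cX | exact: cY].
move=> v vN; split; first exact: A_X'.
have [k _ [] vE] := arcs v; first by rewrite vE; apply: cX'.
by move: vN; rewrite vE b_frozen.
Qed.

Lemma arc_index : exists idx : V -> nat,
  (forall k, idx (e k) = k %% n.+1)%N /\ (forall k, idx (b k) = k %% n.+1)%N.
Proof.
have /choice[idx idxP] : forall v, exists k, (k < n.+1)%N /\ (v = e k \/ v = b k).
  by move=> v; have [k] := arcs v; exists k.
exists idx; split=> k.
  have [lt [E|E]] := idxP (e k).
    by apply: e_inj; rewrite ?ltn_mod // -E (periodic_modn eP).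
  by have := e_mutable k; rewrite E b_frozen.
have [lt [E|E]] := idxP (b k).
  by have := b_frozen k; rewrite E (negbTE (e_mutable _)).
by apply: b_inj; rewrite ?ltn_mod // -E (periodic_modn bP).
Qed.

Lemma chart_periodic (L : fieldType) (Z : nat -> bool) (x h : nat -> L) :
  (forall k, Z (k + n.+1)%N = Z k) ->
  (forall k, x (k + n.+1)%N = x k) -> (forall k, h (k + n.+1)%N = h k) ->
  forall k, chart n t Z x h (k + n.+1)%N = chart n t Z x h k.
Proof.
move=> ZP xP hP k.
rewrite /chart /exchange_rest /exchange_coef -[(k + n.+1).+1]addSn !tP ZP !xP !hP.
by rewrite (addnAC k n.+1 n) xP.
Qed.

(** * From coordinates to points *)

Section Surjectivity.
Variable p : nat -> F * F.
Hypothesis pP : forall k, p (k + n.+1)%N = p k.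
Hypothesis p_compatible : forall k, compatible (p k) (p k.+1).

Let x k := (p k).1.
Let h k := (p k).2.
Let Z k := x k == 0.
Let y := chart n t Z x h.

Let xP k : x (k + n.+1)%N = x k. Proof. by rewrite /x pP. Qed.
Let hP k : h (k + n.+1)%N = h k. Proof. by rewrite /h pP. Qed.
Let ZP k : Z (k + n.+1)%N = Z k. Proof. by rewrite /Z xP. Qed.

Let Z_next k : Z k -> ~~ Z k.+1.
Proof.
by case/andP: (p_compatible k) => _; rewrite -/(x k) -/(x k.+1) /Z => h1 h2; rewrite h2 in h1.
Qed.

Let Z_prev k : Z k -> ~~ Z (k + n).
Proof. by move=> zk; apply/negP => /Z_next; rewrite -addnS ZP zk. Qed.

Let h_neq0 k : ~~ Z k -> h k != 0.
Proof.
rewrite /Z -xP -hP addnS; case/andP: (p_compatible (k + n)) => /implyP h1 _.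
exact: h1.
Qed.

Let coef_neq0 k : Z k -> exchange_coef t x h k != 0.
Proof. by move=> /Z_next zk; rewrite /exchange_coef; case: ifP => // _; apply: h_neq0. Qed.

Let y_neq0 k : y k != 0.
Proof.
rewrite /y /chart; case: ifPn => [zk|]; last exact: h_neq0.
rewrite mulf_neq0 ?invr_neq0 ?coef_neq0 //; have zn := Z_next zk; have zp := Z_prev zk.
rewrite (eqP zk) mul0r sub0r oppr_eq0 /exchange_rest; case: ifP => _; apply: mulf_neq0 => //.
exact: h_neq0.
Qed.

Let x' k := if Z k then h k else exchange n t x y k / x k.

Lemma exists_point : exists2 f : cluster_algebra Q -> F, cluster_variety_points f &
  forall k, coordinates f k = p k.
Proof.
have [idx [idx_e idx_b]] := arc_index.
pose z v : K := seed_var s0 v.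
have zeP k : (z \o e) (k + n.+1)%N = (z \o e) k by rewrite /= eP.
have zbP k : (z \o b) (k + n.+1)%N = (z \o b) k by rewrite /= bP.
pose zF v : F := if frozen v then h (idx v) else x (idx v).
(* The value 2 makes the chart equal to [(2 - 1) / 1 = 1] at the indices in [Z], so [YS] is positive
   at [zR] despite the subtraction. *)
pose zR v : rat := if frozen v && Z (idx v) then 2 else 1.
pose yK := chart n t Z (z \o e) (z \o b).
pose Yv v : K := if frozen v then yK (idx v) else z v.
pose YS := Seed (seed_arrows s1) Yv.
have zFe k : zF (e k) = x k.
  by rewrite /zF (negbTE (e_mutable k)) idx_e (periodic_modn xP).
have zFb k : zF (b k) = h k by rewrite /zF b_frozen idx_b (periodic_modn hP).
have zRe k : zR (e k) = 1 by rewrite /zR (negbTE (e_mutable k)).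
have zRb k : zR (b k) = if Z k then 2 else 1.
  by rewrite /zR b_frozen idx_b /= (periodic_modn ZP).
have Ye k : Yv (e k) = z (e k) by rewrite /Yv (negbTE (e_mutable k)).
have Yb k : Yv (b k) = yK k.
  by rewrite /Yv b_frozen idx_b; apply: (periodic_modn (chart_periodic ZP zeP zbP)).
have YP : positive_seed zR YS.
  move=> v; exists 1 => //; have [k _ []->] := arcs v.
    by rewrite /= Ye -(zRe k); apply: evaluates_var.
  rewrite /= Yb /yK; have -> : 1 = chart n t Z (zR \o e) (zR \o b) k.
    rewrite /chart /exchange_coef /exchange_rest /= !zRe !zRb.
    case zk: (Z k) => //; rewrite (negbTE (Z_next zk)).
    by case: ifP => _; rewrite divr1 !mul1r -[2]/(1 + 1) addrK.
  refine (@ev_chart Q rat (evaluates zR) (@evaluatesB Q rat zR) (@evaluatesM Q rat zR)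
    n t (z \o e) (z \o b) (zR \o e) (zR \o b) _ _ _ Z k _).
  - by move=> j; apply: evaluates_var.
  - by move=> j; apply: evaluates_var.
  - exact: (@evaluatesV _ _ zR).
  rewrite /exchange_coef /= zRe zRb => /Z_next/negbTE ->.
  by case: ifP.
(* Mutating [YS] back to the initial quiver tells what to substitute for the initial variables in
   order that those of [s1] become those of [YS]. *)
pose XS := mutates (rev ks) YS.
have rksN : all (fun k => ~~ frozen k) (rev ks) by rewrite all_rev.
have [_ XP] : [/\ cancelled (seed_arrows XS), positive_seed zR XS &
    mutates (rev (rev ks)) XS = YS] by apply: mutates_rev.
rewrite revK => XSY.
have XA : seed_arrows XS = seed_arrows s0.
  have [_ _ <-] := mutates_rev ksN arrows_cancelled (@positive_initial Q).
  by rewrite /XS !mutates_arrows /= /s1 ?mutates_arrows.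
pose c v : K := seed_var XS v.
have ev1 v : evaluates c (seed_var s1 v) (Yv v).
  have := ev_mutates (c := c) ksN (esym XA) XP; rewrite XSY; apply=> u.
  exact: evaluates_var.
have evX' k : evaluates c (X' k) (mutate_var (e k) YS (e k)).
  have Yk : Yv (e k) != 0 by apply: positive_neq0 (YP (e k)).
  exact: (ev_mutate (evaluates1 c) (@evaluatesB _ _ c) (@evaluatesM _ _ c)
    (@evaluatesV _ _ c) (s := s1) Yk ev1 (e k)).
have evFe k : evaluates zF (z (e k)) (x k) by rewrite -zFe; apply: evaluates_var.
have evFb k : evaluates zF (z (b k)) (h k) by rewrite -zFb; apply: evaluates_var.
have evFy k : evaluates zF (yK k) (y k).
  apply: (ev_chart (@evaluatesB _ _ zF) (@evaluatesM _ _ zF)) => //.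
    exact: (@evaluatesV _ _ zF).
  exact: coef_neq0.
have evFx' k : evaluates zF (mutate_var (e k) YS (e k)) (x' k).
  have z0 : z (e k) != 0 by apply: positive_neq0 (@positive_initial Q (e k)).
  have E : exchange n t (seed_var YS \o e) (seed_var YS \o b) k =
      exchange n t (z \o e) yK k.
    by rewrite /exchange /exchange_coef /exchange_rest /= !Ye !Yb.
  rewrite mutate_e // E [seed_var YS _]Ye /x'; case: ifPn => zk.
    (* By the choice of the chart, the numerator is [z (e k) * z (b k)]: the quotient is [z (b k)],
       which is regular although [x k] is zero. *)
    have cK : exchange_coef t (z \o e) (z \o b) k != 0.
      by rewrite /exchange_coef /=; case: ifP => _; apply: positive_neq0 (@positive_initial Q _).
    have -> : exchange n t (z \o e) yK k = z (e k) * z (b k).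
      exact (@chart_exchange n t Z K (z \o e) (z \o b) k zk (Z_next zk) cK).
    by rewrite mulrC mulKf.
  apply: evaluatesM; last by apply: evaluatesV.
  exact: (ev_exchange (evaluates1 zF) (@evaluatesB _ _ zF) (@evaluatesM _ _ zF)).
(* Substitution of [c] followed by specialization at [zF]; the intermediate field avoids dividing by
   coordinates that vanish in [F]. *)
pose G w r := exists2 w', evaluates c w w' & evaluates zF w' r.
have GX k : G (X k) (x k) by exists (z (e k)); [have := ev1 (e k); rewrite Ye | exact: evFe].
have GY k : G (Y k) (y k) by exists (yK k); [have := ev1 (b k); rewrite Yb | exact: evFy].
have GX' k : G (X' k) (x' k).
  by exists (mutate_var (e k) YS (e k)); [exact: evX' | exact: evFx'].
have G1 : G 1 1 by exists 1; apply: evaluates1.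
have GB w w' r r' : G w r -> G w' r' -> G (w - w') (r - r').
  by move=> [u h1 h2] [u' h3 h4]; exists (u - u'); apply: evaluatesB.
have GM w w' r r' : G w r -> G w' r' -> G (w * w') (r * r').
  by move=> [u h1 h2] [u' h3 h4]; exists (u * u'); apply: evaluatesM.
have Gfun w r r' : G w r -> G w r' -> r = r'.
  by move=> [u h1 h2] [u' h3 h4]; apply: evaluates_fun h2 _; rewrite (evaluates_fun h1 h3).
have GA : forall w, A w -> exists r, G w r.
  apply: (algebra_sub (W := fun w => exists r, G w r)).
  - by exists 1.
  - by move=> u u' [r h1] [r' h2]; exists (r - r'); apply: GB.
  - by move=> u u' [r h1] [r' h2]; exists (r * r'); apply: GM.
  - by move=> v; have [k _ []->] := arcs v; [exists (x k); exact: GX | exists (y k); exact: GY].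
  - move=> v fv; have [k _ []vE] := arcs v.
      by move: fv; rewrite vE (negbTE (e_mutable k)).
    exists (y k)^-1; rewrite vE; have [u h1 h2] := GY k; exists u^-1; last exact: evaluatesV.
    apply: evaluatesV => //; apply: contraNneq (y_neq0 k) => u0.
    rewrite u0 in h2; apply/eqP/(evaluates_fun h2).
    exact: ev0 (evaluates1 zF) (@evaluatesB _ _ zF).
  move=> v vN; have [k _ []vE] := arcs v; last by move: vN; rewrite vE b_frozen.
  by exists (x' k); rewrite vE; apply: GX'.
have /choice[f fG] : forall a : cluster_algebra Q, exists r, G (val a) r.
  by move=> a; apply: GA; apply: val_A.
have fE w r : A w -> G w r -> extension f w = r.
  by move=> /A_val[a ->] h1; rewrite extension_val; apply: Gfun h1.
exists f.
  split; last split.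
  - move=> a a'; exact: Gfun (fG (a - a')) (GB _ _ _ _ (fG a) (fG a')).
  - exact: Gfun (fG 1) G1.
  - move=> a a'; exact: Gfun (fG (a * a')) (GM _ _ _ _ (fG a) (fG a')).
move=> k; rewrite /coordinates (fE _ _ (A_s1 _) (GX k)).
rewrite (fE _ _ (A_X' (e_mutable k)) (GX' k)) (fE _ _ (A_s1 _) (GY k)).
rewrite [RHS]surjective_pairing -/(x k) -/(h k) /x' /y /chart -/(Z k).
by case: (Z k).
Qed.

End Surjectivity.

Lemma card_points : (@cluster_variety_points Q F #=
  `I_#|[set s : n.+1.-tuple (F * F) | cycle (@compatible F) s]%SET|)%card.
Proof.
set H := [set s | _]%SET.
apply/card_set_bijP; exists (fun f => index (point_tuple f) (enum H)); split.
- move=> f fP /=; rewrite cardE index_mem mem_enum inE.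
  exact: point_tuple_cycle.
- move=> f f'; rewrite !inE => fP f'P.
  move=> /(congr1 (nth (point_tuple f) (enum H))).
  by rewrite !nth_index ?mem_enum ?inE ?point_tuple_cycle // => /point_tuple_inj; apply.
move=> i /=; rewrite cardE => hi.
pose s := nth [tuple (0, 0) | _ < n.+1] (enum H) i.
have sH : s \in H by rewrite -mem_enum mem_nth.
pose p k := nth (0, 0) s (k %% n.+1).
have pP k : p (k + n.+1)%N = p k by rewrite /p modnDr.
have sE : mkseq p n.+1 = s.
  apply: (@eq_from_nth _ (0, 0)); rewrite size_mkseq ?size_tuple // => j hj.
  by rewrite nth_mkseq // /p modn_small.
have pC : forall k, compatible (p k) (p k.+1).
  by apply/(periodic_cycle pP); rewrite sE; move: sH; rewrite inE.
have [f fP fE] := exists_point pP pC; exists f => //.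
have -> : point_tuple f = s.
  by apply: val_inj; rewrite /= -sE; apply: eq_mkseq.
by rewrite index_uniq // enum_uniq.
Qed.

End Points.

Theorem proposition5p2 (m : nat) (T : gluing) (hT : triangulates T 0 2 m)
    (F : finFieldType) :
  exists N : nat,
    (@cluster_variety_points (triangulation_quiver T) F #= `I_N)%card /\
    (N%:Z = (#|F|%:Z - 1) ^+ m * (#|F|%:Z ^+ m + (-1) ^+ m))%R.
Proof.
have [euler mE] := triangulates_card hT.
have [conn np _ b2 _] := hT.
pose Q := triangulation_quiver T; pose D := dart T.
pose ar : D -> vertex Q := @dart_arc T; pose op : D -> D := @Defs.opp T.
have oppK : involutive op by apply: opp_involutive.
have ar_opp x : ar (op x) = ar x by apply: ar_oppE.
have ar_eq x y : ar x = ar y -> y = x \/ y = op x by apply: ar_eq_opp.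
have fr x : frozen (ar x) = (op x == x) by apply: boundary_opp.
have sj v : exists x, ar x = v by apply: dart_arc_surj.
have tr0 := @next_side_triangular T.
have np0 : unpunctured op (@next_side T) := no_puncture_unpunctured np.
have cn0 : transitive_on_darts op (@next_side T) := connected_transitive conn.
have [c0 [c0P c0M]] := colouring_of_boundaries conn b2.
have [ks [nx [c [[ksN arE nx3 nxP nxT] [cP cM]]]]] :=
  reduce_to_mixed oppK ar_opp ar_eq fr tr0 np0 cn0 c0P c0M.
have D0 : exists x : D, true by case: c0M => x _; exists x.
have [d0 d0b] := exists_bridge nx3 cM D0.
have cb : #|D| = 3 * #|bridge nx c| := card_bridge nx3 cM.
have [_ cV] := mono_boundary oppK ar_opp sj nx3 cP cM euler.
have nbE := nb_bridgesE oppK ar_opp sj nx3 nxT cP cM euler d0b.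
have om : mono nx c =1 (fun x => op x == x) :=
  opp_mono oppK ar_opp sj nx3 cP cM euler.
(* Each triangle has one bridging dart, and there are two arcs per triangle; so [m], the number of
   arcs minus that of triangles, counts the bridges. *)
have nbm : nb_bridges op nx c d0 = m.
  have h : #|D| = 3 * #|triangle T| by rewrite card_prod card_ord mulnC.
  have h2 : m + #|triangle T| = 2 * #|bridge nx c| by rewrite mE -cV.
  by rewrite nbE; lia.
case: m hT mE nbm => [|n] hT mE nbm.
  by move: nbm; rewrite nbE => /card0_eq/(_ d0); rewrite /in_mem /= d0b.
exists #|[set s : n.+1.-tuple (F * F) | cycle (@compatible F) s]%SET|.
split; last exact: count_cycles.
pose e := bridge_arc ar op nx c d0; pose b := side_arc ar op nx c d0.
pose t k := third_colour nx c (nth_bridge op nx c d0 k).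
have per k : nth_bridge op nx c d0 (k + n.+1) = nth_bridge op nx c d0 k.
  by rewrite -nbm; apply: nth_bridge_periodic.
have bN k := nth_bridgeP oppK nx3 cP d0b k.
have eP k : e (k + n.+1) = e k by rewrite /e /bridge_arc per.
have bP k : b (k + n.+1) = b k by rewrite /b /side_arc per.
have tP k : t (k + n.+1) = t k by rewrite /t per.
have arE' : dart_arrows ar nx = seed_arrows (mutates ks (initial_seed Q)).
  by rewrite mutates_arrows arE.
apply: (@card_points Q F ks ksN _ _ _ n e b t eP bP tP).
- exact (@dart_arrows_cancelled D Q ar (@next_side T)).
- rewrite -arE'; exact (@dart_arrows_cancelled D Q ar nx).
- move=> W W1 WB WM h1 h2 h3.
  apply: (in_cluster_algebra_sub (W := W) oppK ar_opp ar_eq fr sj W1 WB WM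
    (triangulation_arrows T) ksN arE nx3 nxP _ _ h1 h2 h3).
  + move=> x; have := cM x; rewrite -!om /mixed /mono nx3.1.
    by case: (c x) (c (nx x)) (c (nx (nx x))) => [] [] [].
  + move=> x; have := cM x; rewrite -!om /mixed /mono.
    by case: (c x) (c (nx x)) (c (nx (nx x))) => [] [] [].
- move=> k; rewrite fr; exact: (bridge_opp oppK cP (bN k)).
- move=> k; rewrite fr; apply/eqP; exact: (side_dart_boundary oppK ar_opp sj nx3 cP cM euler (bN k)).
- by move=> v; rewrite -nbm; exact: (arc_cases oppK ar_opp sj nx3 nxT cP cM euler d0b).
- by move=> i j; rewrite -nbm; exact: (bridge_arc_inj oppK ar_eq nx3 cP d0b).
- by move=> i j; rewrite -nbm; exact: (side_arc_inj oppK ar_opp ar_eq sj nx3 cP cM euler d0b).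
- move=> s k sE.
  have xN : op (nth_bridge op nx c d0 k) != nth_bridge op nx c d0 k.
    exact: (bridge_opp oppK cP (bN k)).
  rewrite arE' -sE in arE *.
  have -> : e k = ar (nth_bridge op nx c d0 k) by [].
  rewrite (@flip_var _ Q ar op oppK ar_opp ar_eq fr nx _ s nx3 nxP xN); last by rewrite sE.
  congr (_ / _)%R; rewrite /exchange /exchange_coef /exchange_rest /=.
  have := bridge_corner_opp ar oppK nx3 cP d0b k.
  (* The successor of [k + n] is [k] up to a period, so this describes the triangle of the [k]-th
     bridge, with [k + n] standing for [k - 1]. *)
  have := bridge_corner oppK ar_opp nx3 cP d0b (k + n).
  cbv zeta; rewrite -addnS per -/(t k) -/(t k.+1) -/e -/b bP.
  by case: (t k) => -[-> ->]; case: (t k.+1) => -[-> ->] /=; ring.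
exact: (third_colour_change oppK ar_opp sj nx3 nxP nxT cP cM euler d0b).
Qed.
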